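(* Let $l,N,s\ge1$, let $x^{\pm}=(x_1^{\pm1},\dots,x_N^{\pm1})$, and let $\mu=(\mu_1,\dots,\mu_l)$ and $\lambda$ be partitions with $\mu\subset\lambda$, $l(\lambda)\le l+N$ and $\lambda_1\le s$. Then $$so_{\lambda/\mu}(x^{\pm})=\det\big(e_{\lambda'_i-\mu'_j-i+j}(x^{\pm})+e_{\lambda'_i+\mu'_j-i-j-2l+1}(x^{\pm})\big)_{i,j=1}^{s}.$$
   Context: Partitions may have zero entries; $l(\lambda)$ is the number of nonzero entries; $\mu\subset\lambda$ means $\mu_i\le\lambda_i$ for all $i$. $\lambda'$ denotes the conjugate partition ($\lambda'_i=\#\{j:\lambda_j\ge i\}$), extended by zeros so that $\lambda'_i,\mu'_i$ are defined for $1\le i\le s$. The elementary symmetric functions are defined by $\prod_{i=1}^N(1+x_iz)(1+x_i^{-1}z)=\sum_ie_i(x^{\pm})z^i$, with $e_n(x^\pm)=0$ for $n<0$ (and for $n>2N$). Writing $\lambda=(\lambda_1,\dots,\lambda_{l+N})$ (padded by zeros), the skew odd orthogonal character is $so_{\lambda/\mu}(x^{\pm})=\langle\mu^{so}|\Gamma_+(x^{\pm})|\lambda^{so}\rangle$, with the following definitions. Heisenberg algebra: generators $a_n$ ($n\in\mathbb Z\setminus\{0\}$) with $[a_m,a_n]=m\delta_{m,-n}$. The Fock space $\mathcal M$ is generated by the vacuum $|0\rangle$ with $a_n|0\rangle=0$ for $n>0$ (so $\mathcal M\cong\mathbb C[a_{-1},a_{-2},\dots]$), and $\langle 0|$ is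 the dual vacuum, a linear functional on $\mathcal M$ with $\langle 0|a_{-n}=0$ for $n>0$ and $\langle 0|1|0\rangle=1$. Vertex operators: $$U(z)=(1+z)\exp\Big(\sum_{n\ge1}\tfrac{a_{-n}}{n}z^n\Big)\exp\Big(-\sum_{n\ge1}\tfrac{a_n}{n}(z^n+z^{-n})\Big)=\sum_{n\in\mathbb Z}U_nz^{-n},$$ $$U^*(z)=(1-z)\exp\Big(-\sum_{n\ge1}\tfrac{a_{-n}}{n}z^n\Big)\exp\Big(\sum_{n\ge1}\tfrac{a_n}{n}(z^n+z^{-n})\Big)=\sum_{n\in\mathbb Z}U^*_nz^{n}.$$ For $\lambda=(\lambda_1,\dots,\lambda_k)$, $|\lambda^{so}\rangle=U_{-\lambda_1}\cdots U_{-\lambda_k}|0\rangle$ and $\langle\lambda^{so}|=\langle0|U^*_{-\lambda_k}\cdots U^*_{-\lambda_1}$ (the latter depends on the number $k$ of entries). Finally $\Gamma_+(z)=\exp\big(\sum_{n\ge1}\frac{a_n}{n}z^n\big)$ and $\Gamma_+(x^{\pm})=\prod_{i=1}^N\Gamma_+(x_i)\Gamma_+(x_i^{-1})$. *)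

(* Defs.v *)
From HB Require Import structures.
From mathcomp Require Import all_boot all_order all_algebra finmap.
From mathcomp Require Import boolp classical_sets functions cardinality fsbigop.
From mathcomp Require Import monalg.

Set Implicit Arguments.
Unset Strict Implicit.
Unset Printing Implicit Defensive.

Import Order.TTheory GRing.Theory Num.Theory.

Local Open Scope ring_scope.

(* F[a_{-1}, a_{-2}, ...]; the variable of index i stands for a_{-(i+1)}. *)
Notation fock F := {malg F[{cmonom nat}]}.

Section FockSpace.
Context {F : fieldType}.
Local Notation fock := (fock F).

Implicit Types (v : fock) (i n : nat) (m : int).

Definition fvar i : fock := << ucm i >>.

Definition fderiv i v : fock :=
  \sum_(k <- msupp v) << v@_k *+ (k : {cmonom nat}) i *g divcm k (ucm i) >>.

(* a_{-n} is multiplication by the variable a_{-n} and a_n = n d/d(a_{-n})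
   for n > 0; the Heisenberg algebra has no generator a_0, and the value at 0
   is never used. *)
Definition heis m v : fock :=
  match m with
  | Posz 0 => 0
  | Posz i.+1 => i.+1%:R *: fderiv i v
  | Negz i => fvar i * v
  end.

Definition vac : fock := 1.

Definition dual_vac v : F := v@_(onecm nat).

Lemma mcoeff_fderiv i v (k : {cmonom nat}) :
  (fderiv i v)@_k = v@_(mmul k (ucm i)) *+ (k i).+1.
Proof.
rewrite /fderiv raddf_sum /=.
have U (k' : {cmonom nat}) : k' i != 0%N -> (divcm k' (ucm i) == k) = (k' == mmul k (ucm i)).
  move=> k'i; apply/eqP/eqP => [<-|->]; apply/eqP/cmP => j.
    rewrite cmM divcmE ucmE; case: eqVneq => [<-|_]; last by rewrite subn0 addn0.
    by rewrite subnK // lt0n.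
  by rewrite divcmE cmM ucmE addnK.
have E (k' : {cmonom nat}) : (<< v@_k' *+ k' i *g divcm k' (ucm i) >>)@_k =
    if k' == mmul k (ucm i) then v@_k' *+ k' i else 0.
  rewrite mcoeffU; have [k'0|k'i] := eqVneq (k' i) 0%N; last first.
    by rewrite U //; case: ifP => _; rewrite ?mulr1n ?mulr0n.
  by rewrite k'0 mulr0n mul0rn; case: ifP.
rewrite (eq_bigr _ (fun k' _ => E k')) -big_mkcond /=.
have [ks|ks] := boolP (mmul k (ucm i) \in msupp v).
  rewrite (big_rem _ ks) /= eqxx cmM cmUU addn1.
  rewrite big_seq_cond big1 ?addr0 // => k' /andP[+ /eqP k'E].
  by rewrite {1}k'E mem_rem_uniqF // fset_uniq.
rewrite (mcoeff_outdom ks) mul0rn big_seq_cond big1 // => k' /andP[+ /eqP k'E].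
by rewrite k'E (negbTE ks).
Qed.

Lemma mcoeff_fvarM i v (k : {cmonom nat}) :
  (fvar i * v)@_k = if (0 < k i)%N then v@_(divcm k (ucm i)) else 0.
Proof.
have E (k' : {cmonom nat}) : (mmul (ucm i) k' == k) = (0 < k i)%N && (k' == divcm k (ucm i)).
  apply/eqP/andP => [<-|[ki /eqP->]]; last first.
    apply/eqP/cmP => j; rewrite cmM divcmE ucmE.
    by case: eqVneq => [<-|_]; [rewrite subnKC|rewrite subn0].
  split; first by rewrite cmM cmUU.
  by apply/eqP/eqP/cmP => j; rewrite divcmE cmM addKn.
rewrite /fvar -[_ * _]/(fgmul _ _) fgmulUg raddf_sum /=.
under eq_bigr => k' _ do rewrite mcoeffU mul1r E.
case: (0 < k i)%N => /=; last by rewrite big1 // => k' _; rewrite mulr0n.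
have [ks|ks] := boolP (divcm k (ucm i) \in msupp v).
  rewrite (big_rem _ ks) /= eqxx mulr1n big_seq big1 ?addr0 // => k' k's.
  case: eqP k's => [->|_ _]; last by rewrite mulr0n.
  by rewrite mem_rem_uniqF // fset_uniq.
rewrite (mcoeff_outdom ks) big_seq big1 // => k' k's.
by case: eqP k's => [->|_ _]; rewrite ?mulr0n // (negbTE ks).
Qed.

Local Opaque fderiv.

Lemma fderiv_fvarM i j v :
  fderiv i (fvar j * v) = (i == j)%:R *: v + fvar j * fderiv i v.
Proof.
apply/malgP => k.
rewrite mcoeff_fderiv mcoeff_fvarM mcoeffD mcoeff_fvarM mcoeffZ cmM ucmE.
have [<-|ij] := eqVneq i j.
  rewrite addn1 /= mul1r.
  have -> : divcm (mmul k (ucm i)) (ucm i) = k.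
    by apply/eqP/cmP => l; rewrite divcmE cmM addnK.
  case: ifP => [k0|/negbT]; last by rewrite -eqn0Ngt => /eqP->; rewrite addr0 mulr1n.
  rewrite mcoeff_fderiv mulrS divcmE ucmE eqxx subn1 prednK //.
  congr (_ + v@_(_) *+ _); apply/eqP/cmP => l.
  by rewrite cmM divcmE ucmE; case: eqP => [<-|_]; rewrite ?subn0 ?addn0 // subnK.
rewrite addn0 mul0r add0r; case: ifP => k0; last by rewrite mul0rn.
rewrite mcoeff_fderiv divcmE ucmE (eq_sym j) (negbTE ij) subn0.
congr (v@_(_) *+ _); apply/eqP/cmP => l; rewrite !(cmM, divcmE, ucmE).
have [jl|_] := eqVneq j l; last by rewrite !subn0.
by rewrite -jl (negbTE ij) !addn0.
Qed.

Lemma fderivC i j v : fderiv i (fderiv j v) = fderiv j (fderiv i v).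
Proof.
apply: (proj1 (malgP _ _)) => k.
have E a b : (fderiv a (fderiv b v))@_k =
    v@_(mmul (mmul k (ucm a)) (ucm b)) *+ ((k b + (a == b)).+1 * (k a).+1).
  by rewrite mcoeff_fderiv mcoeff_fderiv cmM ucmE mulrnA.
rewrite [LHS]E [RHS]E -!mulmA (mulmC (ucm i)).
have [->//|ij] := eqVneq i j.
by rewrite !addn0 mulnC.
Qed.

Lemma fderivZ i (c : F) v : fderiv i (c *: v) = c *: fderiv i v.
Proof.
apply: (proj1 (malgP _ _)) => k.
by rewrite [RHS]mcoeffZ [LHS]mcoeff_fderiv mcoeffZ mcoeff_fderiv mulrnAr.
Qed.

Lemma heis_comm m1 m2 v : m1 != 0 -> m2 != 0 ->
  heis m1 (heis m2 v) - heis m2 (heis m1 v) =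
  (if m1 == - m2 then m1%:~R else 0) *: v.
Proof.
have AC (b c : F) (w w' : fock) : w = w' -> b *: (c *: w) - c *: (b *: w') = 0.
  by move=> <-; rewrite [X in X - _]scalerA [X in _ - X]scalerA mulrC subrr.
have HC (h l : nat) w : h.+1%:R *: fderiv h (fvar l * w) -
    fvar l * (h.+1%:R *: fderiv h w) = (if h == l then h.+1%:R else 0) *: w.
  rewrite fderiv_fvarM scalerDr -[X in _ - X]scalerAr addrK scalerA.
  by case: eqP => _; rewrite ?mulr1 ?mulr0.
case: m1 m2 => [[|i]|i] [[|j]|j] // _ _; rewrite /heis.
- rewrite (fderivZ i j.+1%:R) (fderivZ j i.+1%:R) scale0r.
  by apply: AC; apply: fderivC.
- by rewrite HC NegzE opprK eqz_nat eqSS.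
- rewrite -opprB HC NegzE eqr_opp eqz_nat eqSS eq_sym.
  by case: eqP => [->|_]; rewrite ?mulrNz ?scaleNr // !scale0r oppr0.
- by rewrite [X in X - _]mulrCA subrr scale0r.
Qed.

Lemma heis_vac i : heis i.+1 vac = 0.
Proof.
apply/malgP => k; rewrite /= mcoeffZ mcoeff_fderiv /vac mcoeff1.
case: eqP => [/eqP/cmP/(_ i)|_]; last by rewrite !(mul0rn, mulr0n, mulr0, mcoeff0).
by rewrite cmM cmUU cm1 addn1.
Qed.

Lemma dual_vac_heis i v : dual_vac (heis (Negz i) v) = 0.
Proof. by rewrite /dual_vac /= mcoeff_fvarM cm1. Qed.

Lemma dual_vac_vac : dual_vac vac = 1.
Proof. by rewrite /dual_vac /vac mcoeff1 eqxx. Qed.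

End FockSpace.

(* A sum \sum_(i \in [set: T]) E i is the sum of the nonzero terms E i; it is 0
   by convention when there are infinitely many of them.  This never happens
   below for V := fock F and a := heis: a vector of weight d (a_{-n} having
   weight n) is killed by any product of more than d operators a_n, n > 0, and
   the coefficient of z^m in (\sum_{n >= 1} a_{-n} z^n / n)^j is 0 for m < j. *)
Section VertexOperators.
Context {F : fieldType} {V : lmodType F}.
Variable a : int -> V -> V.

Implicit Types (v : V) (m : int) (c : F).

(* A represents \sum_{m in Z} (A m) z^m. *)
Definition op_series := int -> V -> V.

Definition poly_series (p : {poly F}) : op_series :=
  fun m v => match m with Posz k => p`_k *: v | Negz _ => 0 end.

Definition series_mul (A B : op_series) : op_series :=
  fun m v => \sum_(p \in [set: int]) A p (B (m - p) v).

Definition series_opp (A : op_series) : op_series := fun m v => - A m v.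

Definition series_pow (A : op_series) (j : nat) : op_series :=
  iter j (series_mul A) (poly_series 1).

Definition series_exp (A : op_series) : op_series :=
  fun m v => \sum_(j \in [set: nat]) j`!%:R^-1 *: series_pow A j m v.

(* \sum_{n >= 1} a_{-n} z^n / n *)
Definition cre_series : op_series :=
  fun m v => match m with Posz n.+1 => n.+1%:R^-1 *: a (Negz n) v | _ => 0 end.

(* \sum_{n >= 1} a_n (z^n + z^{-n}) / n *)
Definition ann_series : op_series :=
  fun m v => if m == 0 then 0 else `|m|%:R^-1 *: a `|m|%N v.

Definition U_series : op_series :=
  series_mul (poly_series (1 + 'X))
    (series_mul (series_exp cre_series) (series_exp (series_opp ann_series))).

Definition Ustar_series : op_series :=
  series_mul (poly_series (1 - 'X))
    (series_mul (series_exp (series_opp cre_series)) (series_exp ann_series)).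

(* U(z) = \sum_n U_n z^{-n} but U^*(z) = \sum_n U^*_n z^n. *)
Definition U_mode (n : int) : V -> V := U_series (- n).
Definition Ustar_mode (n : int) : V -> V := Ustar_series n.

Definition so_ket (vac : V) (lam : seq nat) : V :=
  foldr (fun (p : nat) v => U_mode (- p%:Z) v) vac lam.

(* <0| U^*_{-mu_k} ... U^*_{-mu_1}: the factor of mu_1 acts first. *)
Definition so_bra (dvac : V -> F) (mu : seq nat) (v : V) : F :=
  dvac (foldl (fun v (p : nat) => Ustar_mode (- p%:Z) v) v mu).

Definition Gamma_log c v : V :=
  \sum_(n \in [set n : nat | (0 < n)%N]) (c ^+ n / n%:R) *: a n v.

Definition Gamma_plus c v : V :=
  \sum_(j \in [set: nat]) j`!%:R^-1 *: iter j (Gamma_log c) v.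

Definition Gamma_plus_pm N (x : 'I_N -> F) : V -> V :=
  \big[comp/idfun]_(i < N) (Gamma_plus (x i) \o Gamma_plus (x i)^-1).

End VertexOperators.

Definition is_part (lam : seq nat) : bool := sorted geq lam.

Definition part_len (lam : seq nat) : nat := count (fun p => p != 0%N) lam.

(* lam_i with 1-based index i is nth 0 lam i.-1. *)
Definition part_sub (mu lam : seq nat) : Prop :=
  forall i : nat, (nth 0%N mu i <= nth 0%N lam i)%N.

(* lam'_i, with i >= 1 *)
Definition conj_part (lam : seq nat) (i : nat) : nat := count (leq i) lam.

Definition pad_part (n : nat) (lam : seq nat) : seq nat :=
  mkseq (nth 0%N lam) n.

(* so_{lam/mu}(x^pm), where mu is given with size mu entries, which fixes the
   number size mu + N of entries of lam. *)
Definition so_skew (F : fieldType) N (x : 'I_N -> F) (lam mu : seq nat) : F :=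
  so_bra heis dual_vac mu
    (Gamma_plus_pm heis x
      (so_ket heis (vac : fock F) (pad_part (size mu + N) lam))).

Definition elem_pm (F : fieldType) N (x : 'I_N -> F) (n : int) : F :=
  match n with
  | Posz k => (\prod_(i < N) ((1 + x i *: 'X) * (1 + (x i)^-1 *: 'X)))`_k
  | Negz _ => 0
  end.

(* Main.v *)
(* Write H(z) = exp(sum a_{-n} z^n / n) and T(z) = exp(sum a_n (z^n + z^-n) / n).
   Since [T(z), a_{-k}] = (z^k + z^-k) T(z) and the a_{-k} generate the Fock
   space from |0>, an identity between vertex operators that is compatible with
   these commutators only has to be checked on |0>, where it becomes a statement
   about the coefficients h_i of H(z), governed by Newton's recursion.  This gives
     U^*_{-q} U_{-p} + U_{-p-1} U^*_{-q-1} = delta_{pq},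
     Gamma_+(x) U^*(z) = (1 - x z) U^*(z) Gamma_+(x),
   and <0| U^*(1/z) = - z^-1 <0| U^*(z).  Moving the U^*'s to the right through
   Gamma_+(x^pm) and the U's is then a Laplace expansion, so that so_{lam/mu} is
   an n x n determinant (n = l + N) of complete symmetric functions h_i(x^pm).
   It is a minor of a unitriangular matrix of size n + s whose inverse has entries
   (-1)^k e_k(x^pm), and the complementary minor of the inverse is the
   determinant of elementary symmetric functions; the complement of
   {lam_j + n - j} in {0, ..., n + s - 1} is {n + i - 1 - lam'_i}. *)

Require Import Defs.
From mathcomp Require Import all_boot all_order all_algebra.
From mathcomp Require Import finmap.
From mathcomp Require Import boolp classical_sets functions cardinality fsbigop.
From mathcomp Require Import monalg.
From mathcomp Require Import zify ring.

Set Implicit Arguments.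
Unset Strict Implicit.
Unset Printing Implicit Defensive.

Import Order.TTheory GRing.Theory Num.Theory.

Local Open Scope ring_scope.

(** * Finitely supported sums and linear maps *)

(** An infinite sum is 0 by convention unless it has finitely many nonzero terms, so every exchange
    of sums has to come with a bound. The weight filtration [wt_le] supplies these bounds. It is
    phrased through annihilators alone, so the vertex operators can be treated on an abstract space
    that is known only through its commutators and its generation from 1.

    The two-term entries have the following origin. An entry of mu gives a column of single h's, at
    index c = mu_j + n - j >= N. The remaining N columns come from the reflection of the dual
    vacuum, which pairs c < N with 2N - 1 - c. The condition c < N thus separates the two kinds, and
    both are columns of one matrix H (1 + K) with K^2 = 0. In its inverse (1 - K) H^-1 the second
    term sits in the rows c >= N instead. The indices complementary to mu that label the rows of the
    final minor are n + j - 1 - mu'_j, which are at least N because mu'_j <= l. Hence every entry of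
    the final determinant has two terms, and 2N - 1 - c - a with n = l + N produces the constant -
    2l + 1. *)

Section FiniteSums.
Context {T : choiceType} {W : zmodType}.
Implicit Types f g : T -> W.

Definition finsupp_in (r : seq T) f := forall p, p \notin r -> f p = 0.

Lemma fsumE r f : uniq r -> finsupp_in r f ->
  \sum_(p \in [set: T]) f p = \sum_(p <- r) f p.
Proof.
move=> ur fr; rewrite (fsbigE r) //=; last by move=> i _; apply: fr.
by apply: eq_bigl => i; rewrite in_setT.
Qed.

Definition fins f := exists r, finsupp_in r f.

Lemma finsD f g : fins f -> fins g -> fins (fun p => f p + g p).
Proof.
move=> [r fr] [s gs]; exists (r ++ s) => p.
by rewrite mem_cat negb_or => /andP[/fr-> /gs->]; rewrite addr0.
Qed.

Lemma fins_sub f g : fins f -> (forall p, f p = 0 -> g p = 0) -> fins g.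
Proof. by move=> [r fr] fg; exists r => p /fr/fg. Qed.

Lemma fsumD f g : fins f -> fins g ->
  \sum_(p \in [set: T]) (f p + g p) =
  \sum_(p \in [set: T]) f p + \sum_(p \in [set: T]) g p.
Proof.
move=> [r fr] [s gs]; pose t := undup (r ++ s).
have ut : uniq t by apply: undup_uniq.
have ft : finsupp_in t f.
  by move=> p; rewrite mem_undup mem_cat negb_or => /andP[/fr].
have gt : finsupp_in t g.
  by move=> p; rewrite mem_undup mem_cat negb_or => /andP[_ /gs].
rewrite !(@fsumE t) ?big_split //.
by move=> p pt; rewrite ft ?gt ?addr0.
Qed.

Lemma fsum_ind (Q : W -> Prop) f : Q 0 -> (forall u v, Q u -> Q v -> Q (u + v)) ->
  (forall p, Q (f p)) -> Q (\sum_(p \in [set: T]) f p).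
Proof. by move=> Q0 QD Qf; apply: big_ind. Qed.

Lemma fsum1 (q : T) (w : W) :
  \sum_(p \in [set: T]) (if p == q then w else 0) = w.
Proof.
rewrite (@fsumE [:: q]) ?big_seq1 ?eqxx // => p.
by rewrite inE => /negbTE->.
Qed.

End FiniteSums.

Lemma fsum_morph (T : choiceType) (W W' : zmodType) (h : W -> W') (f : T -> W) :
  h 0 = 0 -> (forall u v, h (u + v) = h u + h v) -> fins f ->
  h (\sum_(p \in [set: T]) f p) = \sum_(p \in [set: T]) h (f p).
Proof.
move=> h0 hD [r fr]; have fr' : finsupp_in (undup r) f.
  by move=> p; rewrite mem_undup; apply: fr.
rewrite !(@fsumE _ _ (undup r)) ?undup_uniq //; last by move=> p /fr'->.
by elim/big_ind2: _ => // _ u _ v <- <-; rewrite hD.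
Qed.

Lemma fins_int (W : zmodType) (f : int -> W) (D : nat) :
  (forall p, (D < `|p|)%N -> f p = 0) -> fins f.
Proof.
move=> fD; exists ([seq i%:Z | i <- iota 0 D.+1] ++ [seq - i%:Z | i <- iota 0 D.+1]).
move=> p; rewrite mem_cat negb_or => /andP[p1 p2]; apply: fD.
rewrite ltnNge; apply/negP => pD.
case: p p1 p2 pD => n p1 p2 pD; [move/negP: p1|move/negP: p2]; apply.
  by apply/mapP; exists n; rewrite ?mem_iota.
by apply/mapP; exists n.+1; rewrite ?mem_iota ?NegzE //=.
Qed.

Lemma fins_nat (W : zmodType) (f : nat -> W) (D : nat) :
  (forall p, (D < p)%N -> f p = 0) -> fins f.
Proof.
move=> fD; exists (iota 0 D.+1) => p; rewrite mem_iota /= add0n -leqNgt.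
exact: fD.
Qed.

Lemma fsum_nat (W : zmodType) (f : nat -> W) (D : nat) :
  (forall j, (D <= j)%N -> f j = 0) ->
  \sum_(j \in [set: nat]) f j = \sum_(j < D) f j.
Proof.
move=> fD; rewrite (@fsumE _ _ (iota 0 D)) ?iota_uniq.
- by rewrite -(big_mkord xpredT) /index_iota subn0.
- by [].
- by move=> j; rewrite mem_iota /= add0n -leqNgt; apply: fD.
Qed.

Lemma fsum_Posz (W : zmodType) (f : int -> W) (D : nat) :
  (forall n, f (Negz n) = 0) -> (forall n, (D <= n)%N -> f (Posz n) = 0) ->
  \sum_(p \in [set: int]) f p = \sum_(q < D) f (Posz q).
Proof.
move=> fn fD; rewrite (@fsumE _ _ [seq Posz q | q <- iota 0 D]).
- by rewrite big_map -(big_mkord xpredT (fun q => f (Posz q))) /index_iota subn0.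
- by rewrite map_inj_uniq ?iota_uniq // => ? ? [].
- case=> n // nD; apply: fD; rewrite leqNgt; apply: contra nD => nD.
  by apply/mapP; exists n; rewrite ?mem_iota.
Qed.

Lemma fsumB (T : choiceType) (W : zmodType) (f g : T -> W) : fins f -> fins g ->
  \sum_(p \in [set: T]) (f p - g p) =
  \sum_(p \in [set: T]) f p - \sum_(p \in [set: T]) g p.
Proof.
move=> ff fg; rewrite fsumD //; last by apply: fins_sub fg _ => p ->; rewrite oppr0.
by congr (_ + _); rewrite (@fsum_morph _ _ _ -%R) ?oppr0 // => *; rewrite opprD.
Qed.

Lemma finsB (T : choiceType) (W : zmodType) (f g : T -> W) :
  fins f -> fins g -> fins (fun p => f p - g p).
Proof. by move=> ff fg; apply: finsD ff _; apply: fins_sub fg _ => p ->; rewrite oppr0. Qed.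

Lemma sum_ord_widen (W : zmodType) (f : nat -> W) k M : (k <= M)%N ->
  (forall i, (k <= i)%N -> f i = 0) -> \sum_(i < k) f i = \sum_(i < M) f i.
Proof.
move=> kM f0; rewrite (big_ord_widen_cond M xpredT f) //=.
rewrite [RHS](bigID (fun i : 'I_M => (i < k)%N)) /= [X in _ = _ + X]big1 ?addr0 // => i.
by rewrite -leqNgt; apply: f0.
Qed.

Section Linear.
Context {F : fieldType} {V W : lmodType F}.

Definition lin (f : V -> W) := forall c u v, f (c *: u + v) = c *: f u + f v.

Context {f : V -> W} (fl : lin f).

Lemma linD u v : f (u + v) = f u + f v.
Proof. by rewrite -[u]scale1r fl !scale1r. Qed.

Lemma lin0 : f 0 = 0.
Proof. by apply: (@addrI _ (f 0)); rewrite -linD !addr0. Qed.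

Lemma linZ c u : f (c *: u) = c *: f u.
Proof. by rewrite -[c *: u]addr0 fl lin0 addr0. Qed.

Lemma linN u : f (- u) = - f u.
Proof. by rewrite -scaleN1r linZ scaleN1r. Qed.

Lemma linB u v : f (u - v) = f u - f v.
Proof. by rewrite linD linN. Qed.

Lemma lin_sum I (r : seq I) (P : pred I) (E : I -> V) :
  f (\sum_(i <- r | P i) E i) = \sum_(i <- r | P i) f (E i).
Proof. by elim/big_rec2: _ => [|i _ u _ <-]; rewrite ?lin0 ?linD. Qed.

Lemma lin_fsum (T : choiceType) (E : T -> V) : fins E ->
  f (\sum_(p \in [set: T]) E p) = \sum_(p \in [set: T]) f (E p).
Proof. by move=> Ef; apply: fsum_morph => //; [apply: lin0|apply: linD]. Qed.

End Linear.

Lemma fsum_lin (F : fieldType) (V W : lmodType F) (T : choiceType) (E : T -> V -> W) :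
  (forall p, lin (E p)) -> (forall v, fins (E^~ v)) ->
  lin (fun v => \sum_(p \in [set: T]) E p v).
Proof.
move=> El Ef c u v.
under eq_fsbigr do rewrite El.
rewrite fsumD ?Ef //; last by apply: fins_sub (Ef u) _ => p ->; rewrite scaler0.
rewrite -(@fsum_morph _ _ _ ( *:%R c)) ?scaler0 //.
by move=> *; rewrite scalerDr.
Qed.

Lemma lin_scale (F : fieldType) (V : lmodType F) (c : F) (f : V -> V) :
  lin f -> lin (fun v => c *: f v).
Proof. by move=> fl a u v; rewrite fl scalerDr !scalerA mulrC. Qed.

Lemma scale_commutator (F : fieldType) (V : comAlgType F) (c : F) (b : bool) (v x w : V) :
  c *: (b%:R *: v + x * w) = x * (c *: w) + (if b then c *: v else 0).
Proof.
rewrite scalerDr scalerAr addrC; congr (_ + _).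
by case: b; rewrite ?scale1r ?scale0r ?scaler0.
Qed.

Lemma mul_lin (F : fieldType) (V : comAlgType F) (u : V) : lin ( *%R u).
Proof. by move=> c v w; rewrite mulrDr scalerAr. Qed.

(** * Newton's recursion *)

Section Newton.
Context {M : zmodType}.
Implicit Types (P : nat -> M -> M) (c : M -> M) (f g : nat -> M).

(* Newton's recursion i h_i = \sum_{q = 1}^i p_q h_{i-q}, with P q for p_{q+1}. *)
Definition newton P f :=
  forall i, f i.+1 *+ i.+1 = \sum_(q < i.+1) P q (f (i - q)%N).

Definition twist c f i := if i is k.+1 then f i - c (f k) else f i.

Lemma newton_uniq P f g :
  (forall (x y : M) n, x *+ n.+1 = y *+ n.+1 -> x = y) ->
  newton P f -> newton P g -> f 0%N = g 0%N -> f =1 g.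
Proof.
move=> inj nf ng fg0 i; elim/ltn_ind: i => -[|i] IH //.
apply: (inj _ _ i); rewrite nf ng; apply: eq_bigr => q _.
by rewrite IH // ltnS leq_subr.
Qed.

Lemma eq_newton P P' f : (forall q x, P q x = P' q x) -> newton P f -> newton P' f.
Proof. by move=> PP nf i; rewrite nf; apply: eq_bigr => q _; rewrite PP. Qed.

(* Multiplying exp(\sum_q p_q w^q / q) by 1 - c w replaces p_q by p_q - c^q. *)
Lemma newton_twist P c f :
  (forall q, {morph P q : x y / x - y}) -> {morph c : x y / x - y} ->
  (forall q x, P q (c x) = c (P q x)) ->
  newton P f -> newton (fun q x => P q x - iter q.+1 c x) (twist c f).
Proof.
move=> PB cB Pc nf i.
have c0 : c 0 = 0 by rewrite -[X in c X](subrr 0) cB subrr.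
have cD x y : c (x + y) = c x + c y.
  by rewrite -[y in LHS]opprK cB -[X in _ - c X]sub0r cB c0 sub0r opprK.
have cMn x n : c (x *+ n) = c x *+ n by elim: n => [|n IH]; rewrite ?mulr0n // !mulrS cD IH.
have cS (n : nat) E : c (\sum_(q < n) E q) = \sum_(q < n) c (E q).
  by elim/big_rec2: _ => [|q _ x _ <-]; rewrite ?cD.
have -> : twist c f i.+1 *+ i.+1 = f i.+1 *+ i.+1 - c (f i) *+ i - c (f i).
  by rewrite /= mulrnBl [c (f i) *+ i.+1]mulrSr opprD addrA.
rewrite sumrB.
have -> : \sum_(q < i.+1) P q (twist c f (i - q)) = f i.+1 *+ i.+1 - c (f i) *+ i.
  rewrite nf !big_ord_recr /= subnn /= -addrA [_ - c _ *+ i]addrC addrA; congr (_ + _).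
  case: i => [|i]; first by rewrite !big_ord0 mulr0n subr0.
  rewrite -cMn nf cS -sumrB; apply: eq_bigr => -[q qi] _ /=.
  by rewrite subSn // PB Pc.
(* The terms c^(q+1) applied to [twist c f (i - q)] telescope to [c (f i)]. *)
congr (_ - _); elim: i => [|i IH]; first by rewrite big_ord1.
rewrite big_ord_recl /= -/(twist c f i.+1).
rewrite -[LHS](subrK (c (c (f i)))) -cB; congr (_ + _).
by rewrite IH cS; apply: eq_bigr => q _.
Qed.

End Newton.

(* With H = \sum h_i w^i, H' = \sum h'_i z^i and H(w) H'(w) = 1, the generating
   series a and b are the expansions of H'(z) H(w) / ((1 - z w) (1 - w / z)) in w and of
   H'(z) H(w) / ((1 - z w) (1 - z / w)) in z; the conclusion says that
   (1 - z) (1 + w) (a + (z / w) b) is the delta function \sum_m (w / z)^m. *)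
Lemma fermion_recurrence (R : comNzRingType) (a b : int -> int -> R) (h h' : int -> R) :
  (forall n, h (Negz n) = 0) -> (forall n, h' (Negz n) = 0) ->
  (forall m p, p < 0 -> a m p = 0) -> (forall m p, m < 0 -> b m p = 0) ->
  (forall m p, a m p - a (m - 1) (p - 1) - a (m + 1) (p - 1) + a m (p - 2) = h' m * h p) ->
  (forall m p, b m p - b (m - 1) (p - 1) - b (m - 1) (p + 1) + b (m - 2) p = h p * h' m) ->
  (forall d : nat, \sum_(k < d.+1) h k * h' (d - k)%N = (d == 0)%:R) ->
  let s m p := a m p + b (m - 1) (p + 1) in
  forall m p, s m p + s m (p - 1) - s (m - 1) p - s (m - 1) (p - 1) = (m + p == 0)%:R.
Proof.
move=> hN h'N a0 b0 ra rb conv s.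
have eb m p m' p' : m = m' -> p = p' -> b m p = b m' p' by move=> -> ->.
have ea m p m' p' : m = m' -> p = p' -> a m p = a m' p' by move=> -> ->.
pose b' m p := b m p - b (m - 1) (p - 1).
(* [t] and [b'] are s and b multiplied by 1 - z w alone, with m the exponent of z and p that of
   w. *)
pose t m p := s m p - s (m - 1) (p - 1).
have tE m p : t m p = a m p - a (m - 1) (p - 1) + b' (m - 1) (p + 1).
  rewrite /t /s /b' (eb (m - 1 - 1) (p + 1 - 1) (m - 1 - 1) (p - 1 + 1)) //; last by lia.
  move: (a _ _) (a _ _) (b _ _) (b _ _) => u v w x; ring.
have b'S m p : b' m p = h p * h' m + b' (m - 1) (p + 1).
  rewrite -rb /b' (eb (m - 1 - 1) (p + 1 - 1) (m - 2) p); [|lia|lia].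
  move: (b _ _) (b _ _) (b _ _) (b _ _) => u v w x; ring.
(* The factor 1 - w / z kills t, because the contributions of a and b cancel. So t depends on m + p
   only and can be evaluated at p = - 1, where its a part vanishes and its b part unrolls to the
   convolution in [conv]. *)
have t1 m p : t m p = t (m + 1) (p - 1).
  rewrite !tE (b'S (m + 1 - 1) (p - 1 + 1)).
  have -> : m + 1 - 1 = m by lia.
  have -> : p - 1 + 1 = p by lia.
  rewrite [h p * h' m]mulrC -ra (ea m (p - 1 - 1) m (p - 2)) //; last by lia.
  move: (a _ _) (a _ _) (a _ _) (a _ _) (b' _ _) => u v w x y; ring.
have t1n n m p : t m p = t (m + n%:Z) (p - n%:Z).
  elim: n m p => [|n IH] m p; first by rewrite addr0 subr0.
  by rewrite t1 IH; congr t; lia.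
have t1p n m p : t m p = t (m - n%:Z) (p + n%:Z) by rewrite [RHS](t1n n); congr t; lia.
have tz m p : t m p = t (m + p + 1) (- 1).
  have [p0|p0] := leP 0 (p + 1).
    by rewrite [LHS](t1n (absz (p + 1))); congr t; lia.
  by rewrite [LHS](t1p (absz (p + 1))); congr t; lia.
have b'neg m p : m < 0 -> b' m p = 0 by move=> m0; rewrite /b' !b0 ?subrr //; lia.
have b'n (n : nat) (p : nat) : b' n p = \sum_(k < n.+1) h (p + k)%N * h' (n - k)%N.
  elim: n p => [|n IH] p.
    by rewrite big_ord1 b'S b'neg ?addr0 ?addn0.
  rewrite b'S big_ord_recl addn0 subn0; congr (_ + _).
  have -> : n.+1%:Z - 1 = n by lia.
  have -> : p%:Z + 1 = p.+1 by lia.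
  by rewrite IH; apply: eq_bigr => k _; rewrite lift0 addSnnS.
have td m p : t m p = (m + p == 0)%:R.
  rewrite tz tE !a0 // subrr add0r.
  have -> : m + p + 1 - 1 = m + p by lia.
  have -> : - 1 + 1 = 0 :> int by [].
  case: (m + p) => [d|d]; last by rewrite b'neg.
  by rewrite (b'n d 0%N) -conv; apply: eq_bigr => k _.
(* This difference is constant along diagonals because t depends on m + p only. Far down a diagonal
   both indices are negative, so a and b vanish there. *)
have Dn (n : nat) m p : s m (p - 1) - s (m - 1) p =
    s (m - n%:Z) (p - n%:Z - 1) - s (m - n%:Z - 1) (p - n%:Z).
  elim: n => [|n ->]; first by rewrite !subr0.
  have -> : m - n.+1%:Z = m - n%:Z - 1 by lia.
  have -> : p - n.+1%:Z = p - n%:Z - 1 by lia.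
  move: (m - n%:Z) (p - n%:Z) => {}m {}p.
  have E : t m (p - 1) = t (m - 1) p by rewrite !td; congr (_ == _)%:R; lia.
  have X (u v w x : R) : u - v = w - x -> u - w = v - x.
    by move/eqP; rewrite subr_eq => /eqP ->; ring.
  exact: X E.
move=> m p; rewrite -[RHS]td /t.
have : s m (p - 1) - s (m - 1) p = 0.
  rewrite (Dn (absz m + absz p).+2) /s !a0 ?b0 ?addr0 ?subr0 //; lia.
move/eqP; rewrite subr_eq0 => /eqP ->.
by rewrite addrK.
Qed.

(** * Wick expansion *)

Section DeleteAt.
Context {T : Type}.

Fixpoint delete_at (j : nat) (s : seq T) : seq T :=
  match s, j with
  | [::], _ => [::]
  | _ :: s', 0 => s'
  | x :: s', j'.+1 => x :: delete_at j' s'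
  end.

Lemma size_delete_at j s : (j < size s)%N -> size (delete_at j s) = (size s).-1.
Proof. by elim: s j => // x [|y s] IH [|j] //= jn; rewrite IH. Qed.

Lemma nth_delete_at x0 j s k : nth x0 (delete_at j s) k = nth x0 s (bump j k).
Proof.
elim: s j k => [|x s IH] [|j] [|k] //=; rewrite ?nth_nil //.
by rewrite IH bumpS.
Qed.

End DeleteAt.

Section Wick.
Context {F : fieldType} {V : lmodType F}.
Variables (U Us : int -> V -> V) (G : V -> V) (vac : V) (dual : V -> F^o).
Implicit Types (v : V) (s : seq int).

Hypotheses (U_lin : forall m, lin (U m)) (Us_lin : forall m, lin (Us m)) (G_lin : lin G).
Hypothesis UsU : forall m p v,
  Us m (U p v) + U (p + 1) (Us (m - 1) v) = (m + p == 0)%:R *: v.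
Hypothesis Us_vac : forall m : int, m <= 0 -> Us m vac = (m == 0)%:R *: vac.
Hypothesis Us_low : forall v, exists d : nat, forall m : int, m < - d%:Z -> Us m v = 0.

(* U_{-a_1} ... U_{-a_n} |0> in the shifted coordinates s_i = a_i + n - i. *)
Fixpoint ket s : V := if s is a :: s' then U (a - (size s')%:Z) (ket s') else vac.

(** Anticommuting [Us] past a factor U raises the mode of that factor by 1. In shifted coordinates
    this is exactly what deleting a later entry requires, so the other entries keep their values.
    For b = - 1 the operator reaches the vacuum as [Us 0], which fixes it: this leaves the boundary
    term in which all entries are raised. *)
Lemma wick s (b : int) : - 1 <= b ->
  Us ((size s)%:Z - 1 - b) (ket s) =
  \sum_(j < size s) ((-1) ^+ j * (nth 0 s j == b)%:R) *: ket (delete_at j s)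
  + ((-1) ^+ size s * (b == - 1)%:R) *: ket (map (+%R 1) s).
Proof.
move=> b1; elim: s => [|a s IH] /=.
  rewrite big_ord0 mul1r Us_vac; last by lia.
  by rewrite [RHS]add0r; have -> : (- 1 - b == 0) = (b == - 1) by lia.
set v := ket s in IH *.
have -> : (size s).+1%:Z - 1 - b = (size s)%:Z - b by lia.
have := UsU ((size s)%:Z - b) (a - (size s)%:Z) v.
move/eqP; rewrite eq_sym -subr_eq => /eqP <-.
have -> : (size s)%:Z - b - 1 = (size s)%:Z - 1 - b by lia.
rewrite IH big_ord_recl /= expr0 mul1r.
have -> : ((size s)%:Z - b + (a - (size s)%:Z) == 0) = (a == b) by lia.
rewrite -[RHS]addrA; congr (_ + _).
rewrite (linD (U_lin _)) opprD (lin_sum (U_lin _)) -sumrN; congr (_ + _).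
  apply: eq_bigr => -[j js] _ /=; rewrite (linZ (U_lin _)) -scaleNr.
  rewrite exprS mulN1r mulNr size_delete_at //.
  by congr (_ *: U _ _); lia.
rewrite (linZ (U_lin _)) -scaleNr exprS mulN1r mulNr size_map.
by congr (_ *: U _ _); lia.
Qed.

Variables (E : {poly F}) (h : int -> F).
Hypothesis E0 : E`_0 = 1.
Hypothesis h_neg : forall n : int, n < 0 -> h n = 0.
Hypothesis Eh : forall a : int, \sum_(i < size E) E`_i * h (a - i%:Z) = (a == 0)%:R.
Hypothesis GUs : forall m v,
  G (Us m v) = \sum_(i < size E) E`_i *: Us (m - i%:Z) (G v).

(** Since E has constant term 1, the recurrence expresses d at b through its values at larger
    arguments. *)
Lemma downward_recurrence_eq0 (d : int -> V) (lo : int) :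
  (exists M : nat, forall b, M%:Z <= b -> d b = 0) ->
  (forall b, lo <= b -> \sum_(i < size E) E`_i *: d (b + i%:Z) = 0) ->
  forall b, lo <= b -> d b = 0.
Proof.
move=> [M dM] rec.
have H (n : nat) b : lo <= b -> M%:Z <= b + n%:Z -> d b = 0.
  elim: n b => [|n IH] b lb Mb; first by apply: dM; lia.
  have := rec b lb; have := E0.
  case sE: (size E) => [|k].
    by rewrite nth_default ?sE // => /esym/eqP; rewrite oner_eq0.
  rewrite big_ord_recl => ->; rewrite scale1r addr0 big1 ?addr0 // => i _.
  by rewrite IH ?scaler0 // lift0; lia.
by move=> b lb; apply: (H (absz M + absz b)%N); lia.
Qed.

(* Both sides solve the recurrence in b that GUs imposes and vanish for large b;
   b = - 1 is the smallest value for which Us annihilates or fixes the vacuum. *)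
Lemma wickG s (b : int) : - 1 <= b ->
  Us ((size s)%:Z - 1 - b) (G (ket s)) =
  \sum_(j < size s) ((-1) ^+ j * h (nth 0 s j - b)) *: G (ket (delete_at j s))
  + ((-1) ^+ size s * (b == - 1)%:R) *: G (ket (map (+%R 1) s)).
Proof.
move=> b1; apply/eqP; rewrite -subr_eq0; apply/eqP.
pose R b := \sum_(j < size s) ((-1) ^+ j * h (nth 0 s j - b)) *: G (ket (delete_at j s))
  + ((-1) ^+ size s * (b == - 1)%:R) *: G (ket (map (+%R 1) s)).
pose d b := Us ((size s)%:Z - 1 - b) (G (ket s)) - R b.
rewrite -/(R b) -/(d b); apply: (@downward_recurrence_eq0 d (- 1)) b1 => {b}.
  have [D UD] := Us_low (G (ket s)).
  exists (D + size s + \sum_(j < size s) absz (nth 0%R s j)).+1 => b Db.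
  rewrite /d UD ?sub0r; last by lia.
  rewrite /R; have -> : (b == - 1) = false by lia.
  rewrite mulr0 scale0r addr0 big1 ?oppr0 // => j _.
  rewrite h_neg ?mulr0 ?scale0r //.
  by move: Db; rewrite (bigD1 j) //=; lia.
move=> b b1; rewrite /d.
under eq_bigr => i _ do rewrite scalerBr.
rewrite sumrB; apply/eqP; rewrite subr_eq0; apply/eqP.
transitivity (G (Us ((size s)%:Z - 1 - b) (ket s))).
  by rewrite GUs; apply: eq_bigr => i _; congr (_ *: Us _ _); lia.
rewrite wick // (linD G_lin) (lin_sum G_lin) (linZ G_lin) /R.
under [RHS]eq_bigr => i _ do rewrite scalerDr scaler_sumr.
rewrite big_split /= exchange_big /=; congr (_ + _).
  apply: eq_bigr => j _; rewrite (linZ G_lin).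
  under [RHS]eq_bigr => i _ do rewrite scalerA mulrCA.
  rewrite -scaler_suml -mulr_sumr; congr ((_ * _) *: _).
  rewrite -subr_eq0 -Eh; apply: eq_bigr => i _; congr (_ * h _).
  by rewrite opprD addrA.
under [RHS]eq_bigr => i _ do rewrite scalerA mulrCA.
rewrite -scaler_suml -mulr_sumr; congr ((_ * _) *: _).
case sE: (size E) => [|k].
  by have /esym/eqP := E0; rewrite nth_default ?sE // oner_eq0.
rewrite big_ord_recl E0 mul1r addr0 big1 ?addr0 // => i _.
(* As b >= - 1, the boundary term at b + i survives only for i = 0. *)
have -> : (b + (lift ord0 i)%:Z == -1) = false by rewrite lift0; lia.
by rewrite mulr0.
Qed.

Hypotheses (dual_lin : lin dual) (dual_vac : dual vac = 1) (G_vac : G vac = vac).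
Hypothesis dual_Us : forall m v, dual (Us (m + 1) v) = - dual (Us (- m) v).

Definition vac_col (N k : nat) (a : int) : F :=
  h (a - (N%:Z - 1 - k%:Z)) + h (a - (N%:Z + k%:Z)).

(* By dual_Us the expansions of wickG at b = - 1 and b = 2 size s - 2 have opposite
   dual pairings; their sum is a Laplace expansion along the last column. *)
Lemma vac_matrix_coef s :
  dual (G (ket s)) = \det (\matrix_(j < size s, k < size s) vac_col (size s) k (nth 0 s j)).
Proof.
have [n sn] := ubnP (size s); elim: n s sn => // n IH s sn.
case: s sn => [|a0 s0] sn; first by rewrite det_mx00 /= G_vac.
set s := a0 :: s0; set m := size s0 in sn.
(* Lowering the entries makes [ket s] the boundary term of [wickG] for t at b = - 1. At b = 2m the
   mode of [Us] is - m, the reflection of the mode m + 1 that occurs at b = - 1. *)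
pose t := map (+%R (- 1)) s.
have ts : map (+%R 1) t = s by rewrite -map_comp map_id_in // => x _ /=; lia.
have sz : size t = m.+1 by rewrite size_map.
have W1 := @wickG t (- 1) (lexx _).
have W2 := @wickG t (2 * m%:Z) _.
have -> : dual (G (ket s)) = (-1) ^+ m * \sum_(j < m.+1)
    ((-1) ^+ j * vac_col m.+1 m (nth 0 s j)) * dual (G (ket (delete_at j t))).
  have : dual (Us ((size t)%:Z - 1 - (- 1)) (G (ket t))) +
      dual (Us ((size t)%:Z - 1 - 2 * m%:Z) (G (ket t))) = 0.
    have -> : (size t)%:Z - 1 - (- 1) = m%:Z + 1 by lia.
    have -> : (size t)%:Z - 1 - 2 * m%:Z = - m%:Z by lia.
    by rewrite dual_Us addNr.
  rewrite W1 W2; last by lia.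
  have -> : (2 * m%:Z == -1) = false by lia.
  rewrite ts eqxx mulr0 mulr1 scale0r addr0 !(linD dual_lin) !(lin_sum dual_lin) sz.
  rewrite (linZ dual_lin) addrAC -big_split /= => /eqP; rewrite addrC addr_eq0 => /eqP E1.
  rewrite -[LHS](signrMK m.+1) [X in _ * X]E1 exprS mulN1r mulrNN; congr (_ * _).
  apply: eq_bigr => -[j js] _ /=; rewrite !(linZ dual_lin) -scalerDl -mulrDr.
  have tj : nth 0 t j = nth 0 s j - 1.
    by rewrite (nth_map 0) // addrC.
  rewrite tj; move: (nth 0 s j) => x.
  suff -> : vac_col m.+1 m x = h (x - 1 - - 1) + h (x - 1 - 2 * m%:Z) by [].
  by rewrite /vac_col; congr (h _ + h _); lia.
rewrite (expand_det_col _ ord_max) mulr_sumr; apply: eq_bigr => j _.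
have sd : size (delete_at j t) = m by rewrite size_delete_at sz.
have R (x y c d : F) : x * (y * c * d) = c * (y * x * d) by ring.
rewrite mxE IH ?sd // R /cofactor exprD; congr (_ * (_ * _)).
apply: (congr1 (@determinant _ m)); apply/matrixP => i k; rewrite !mxE.
rewrite nth_delete_at (nth_map 0); last by exact: (ltn_ord (lift j i)).
rewrite lift_max -[bump j i]/(nat_of_ord (lift j i)).
(* [vac_col] depends on a and N through a - N only, so lowering the entries compensates for the loss
   of one entry. *)
have vac_colS (k' : nat) (x : int) : vac_col m k' (- 1 + x) = vac_col m.+1 k' x.
  by rewrite /vac_col; congr (h _ + h _); lia.
exact: vac_colS.
Qed.

(** An entry of mu is extracted at some b >= 0, where [wickG] has no boundary term and no reflection
    is involved; its column therefore has single entries h. *)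
Fixpoint col_fun (mu : seq nat) (N i : nat) (a : int) : F :=
  match mu, i with
  | [::], _ => vac_col N i a
  | p :: mu', 0 => h (a - (p + (size mu' + N))%N%:Z)
  | _ :: mu', i'.+1 => col_fun mu' N i' a
  end.

Lemma matrix_coef mu N s : size s = (size mu + N)%N ->
  dual (foldl (fun v (p : nat) => Us (- p%:Z) v) (G (ket s)) mu) =
  \det (\matrix_(j < size mu + N, i < size mu + N) col_fun mu N i (nth 0 s j)).
Proof.
elim: mu s => [|p mu IH] s sz /=.
  by rewrite vac_matrix_coef sz.
set m := (size mu + N)%N in sz *.
have fl (mu' : seq nat) : lin (fun v => foldl (fun v (p : nat) => Us (- p%:Z) v) v mu').
  by elim: mu' => //= q mu' IHq c u v; rewrite Us_lin IHq.
have := @wickG s (p + m)%N%:Z _.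
have {}sz : size s = m.+1 by rewrite sz.
have -> : (size s)%:Z - 1 - (p + m)%N%:Z = - p%:Z by rewrite sz; lia.
move=> -> //; have -> : ((p + m)%N%:Z == -1) = false by lia.
rewrite mulr0 scale0r addr0 (lin_sum (fl mu)) (lin_sum dual_lin) sz.
rewrite (expand_det_col _ ord0); apply: eq_bigr => j _.
rewrite (linZ (fl mu)) (linZ dual_lin) IH; last by rewrite size_delete_at sz.
have R (x y d : F) : x * y * d = y * (x * d) by ring.
rewrite mxE /= /cofactor addn0 [LHS]R; congr (_ * (_ * _)).
apply: (congr1 (@determinant _ m)); apply/matrixP => i k; rewrite !mxE.
by rewrite nth_delete_at.
Qed.

End Wick.

Lemma coef_exp_small (R : nzRingType) (p : {poly R}) j i :
  p`_0 = 0 -> (i < j)%N -> (p ^+ j)`_i = 0.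
Proof.
move=> p0; elim: j i => // j IH i ij; rewrite exprS coefM big1 // => -[q qi] _ /=.
by case: q qi => [|q] qi; rewrite ?p0 ?mul0r // IH ?mulr0 //; lia.
Qed.

(** * Complementary minors *)

(* [maya m a a']: a (decreasing) and a' (increasing) partition {0, ..., m-1}. *)
Inductive maya : nat -> seq nat -> seq nat -> Prop :=
| Maya0 : maya 0 [::] [::]
| MayaL m a a' of maya m a a' : maya m.+1 (m :: a) a'
| MayaR m a a' of maya m a a' : maya m.+1 a (rcons a' m).

Lemma maya_perm m a a' : maya m a a' -> perm_eq (a ++ a') (iota 0 m).
Proof.
elim=> {m a a'} // m a a' _ IH; rewrite -addn1 iotaD /= add0n perm_sym perm_catC perm_sym /=.
  by rewrite perm_cons.
by rewrite -rcons_cat perm_rcons perm_cons.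
Qed.

Section Sign.
Context {F : fieldType}.

(** A permutation matrix when u rearranges 0, ..., m - 1. Keeping u a plain sequence lets its
    determinant follow the induction on [maya]. *)
Definition seq_mx m (u : seq nat) : 'M[F]_m := \matrix_(i, j) (nth 0%N u i == j)%:R.

Lemma seq_mx_orth m u : perm_eq u (iota 0 m) -> seq_mx m u *m (seq_mx m u)^T = 1%:M.
Proof.
move=> pu; have su : size u = m by rewrite (perm_size pu) size_iota.
have uu : uniq u by rewrite (perm_uniq pu) iota_uniq.
apply/matrixP => i j; rewrite !mxE.
have ui : (nth 0%N u i < m)%N.
  have := mem_nth 0%N (_ : (i < size u)%N); rewrite (perm_mem pu) mem_iota su.
  by move/(_ (ltn_ord i)).
rewrite (bigD1 (Ordinal ui)) //= !mxE eqxx mul1r big1 ?addr0.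
  by rewrite nth_uniq ?su // eq_sym.
by move=> k; rewrite -val_eqE /= => ki; rewrite !mxE eq_sym (negbTE ki) mul0r.
Qed.

(** Expand along the last column. When m enters in front, the determinant changes by (-1)^m; when it
    enters at the end, the determinant is unchanged but the sum over a' grows by m. The right-hand
    side does not depend on the partition, so it cancels between two of them. *)
Lemma maya_sign m a a' : maya m a a' ->
  \det (seq_mx m (a ++ a')) * (-1) ^+ (\sum_(k <- a') k) = (-1) ^+ (\sum_(i < m) i).
Proof.
elim=> {m a a'} [|m a a' H IH|m a a' H IH].
- by rewrite det_mx00 big_nil big_ord0 mulr1.
- have sz : size (a ++ a') = m by rewrite (perm_size (maya_perm H)) size_iota.
  have lt i : (i < m)%N -> (nth 0%N (a ++ a') i < m)%N.
    by rewrite -{1}sz => im; have := mem_nth 0%N im; rewrite (perm_mem (maya_perm H)) mem_iota.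
  rewrite [X in _ = _ ^+ X]big_ord_recr /= (expand_det_col _ ord_max).
  rewrite big_ord_recl big1 ?addr0; last first.
    by move=> i _; rewrite mxE /= ltn_eqF ?mul0r //; apply: lt; apply: ltn_ord.
  have R (x y z : F) : x * y * z = y * z * x by ring.
  rewrite mxE eqxx mul1r /cofactor add0n R exprD -IH; congr (_ * _ * _).
  apply: (congr1 (@determinant _ m)); apply/matrixP => i j; rewrite !mxE.
  by rewrite lift0 lift_max.
- have sz : size (a ++ a') = m by rewrite (perm_size (maya_perm H)) size_iota.
  have lt i : (i < m)%N -> (nth 0%N (a ++ a') i < m)%N.
    by rewrite -{1}sz => im; have := mem_nth 0%N im; rewrite (perm_mem (maya_perm H)) mem_iota.
  rewrite [X in _ = _ ^+ X]big_ord_recr /= (expand_det_col _ ord_max).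
  rewrite big_ord_recr big1 ?add0r; last first.
    move=> i _; rewrite mxE /= -rcons_cat nth_rcons sz ltn_ord ltn_eqF ?mul0r //.
    exact: lt.
  rewrite mxE -rcons_cat nth_rcons sz ltnn !eqxx mul1r /cofactor -signr_odd addnn odd_double.
  rewrite mul1r big_rcons /= addnC !exprD -IH mulrCA mulrC; congr (_ * _ * _).
  rewrite [LHS]add0r.
  apply: (congr1 (@determinant _ m)); apply/matrixP => i j; rewrite !mxE.
  by rewrite !lift_max nth_rcons sz ltn_ord.
Qed.

End Sign.

(** Jacobi's identity for complementary minors. Replacing the first block column of Q by that of the
    identity turns K Q = 1 into a block triangular product. *)
Lemma det_complement (R : comNzRingType) n s (K Q : 'M[R]_(n + s)) :
  K *m Q = 1%:M -> \det (ulsubmx K) = \det K * \det (drsubmx Q).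
Proof.
move=> KQ.
have E : K *m block_mx 1%:M (ursubmx Q) 0 (drsubmx Q) =
    block_mx (ulsubmx K) 0 (dlsubmx K) 1%:M.
  have : block_mx (ulsubmx K) (ursubmx K) (dlsubmx K) (drsubmx K) *m
     block_mx (ulsubmx Q) (ursubmx Q) (dlsubmx Q) (drsubmx Q) = block_mx 1%:M 0 0 1%:M.
    by rewrite !submxK KQ -scalar_mx_block.
  rewrite mulmx_block => /eq_block_mx[_ E2 _ E4].
  by rewrite -{1}[K]submxK mulmx_block !mulmx1 !mulmx0 !addr0 E2 E4.
have := congr1 (@determinant _ _) E.
by rewrite det_mulmx det_ublock det_lblock !det1 mul1r mulr1 => ->.
Qed.

Definition shifted_part (f : nat -> nat) n : seq nat :=
  mkseq (fun j => f j + (n - j.+1))%N n.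

(** The count is the conjugate part f'_(i+1), as i is 0-based. *)
Definition shifted_conj (f : nat -> nat) n s : seq nat :=
  mkseq (fun i => n + i - count (fun j => i < f j)%N (iota 0 n))%N s.

(** Follow the boundary of the diagram of f in an n by s rectangle: a first row of full length s is
    removed by [MayaL]; otherwise the last column is empty and is removed by [MayaR]. *)
Lemma maya_part (f : nat -> nat) n s : {homo f : i j / (i <= j)%N >-> (j <= i)%N} ->
  (f 0 <= s)%N -> maya (n + s) (shifted_part f n) (shifted_conj f n s).
Proof.
elim: n f s => [|n IHn] f s fm f0.
  rewrite add0n /shifted_part /shifted_conj.
  elim: s {f0} => [|s IHs]; first exact: Maya0.
  by rewrite mkseqS /= add0n subn0; apply: MayaR.
have fS : {homo (fun i => f i.+1) : i j / (i <= j)%N >-> (j <= i)%N}.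
  by move=> i j ij; apply: fm.
elim: s f0 => [|s IHs] f0.
  have f00 : f 0%N = 0%N by lia.
  have := IHn _ 0%N fS (_ : (f 1%N <= 0)%N); rewrite !addn0 => /(_ _)/MayaL.
  have -> : n :: shifted_part (fun i => f i.+1) n = shifted_part f n.+1.
    rewrite /shifted_part -[RHS]/(mkseq _ (1 + n)) /mkseq iotaD /= f00 subn1.
    by rewrite (iotaDl 1 0) -map_comp; congr (_ :: _).
  by apply; rewrite -f00; apply: fm.
have [fs|fs] := ltnP (f 0%N) s.+1.
  rewrite addnS.
  have -> : shifted_conj f n.+1 s.+1 = rcons (shifted_conj f n.+1 s) (n.+1 + s)%N.
    rewrite /shifted_conj mkseqS (_ : count _ _ = 0%N) ?subn0 //.
    apply/eqP; rewrite -leqn0 leqNgt -has_count; apply/hasPn => j _.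
    by rewrite -leqNgt (leq_trans (fm 0%N j _)).
  exact/MayaR/IHs.
have f0s : f 0%N = s.+1 by lia.
rewrite addSn.
have -> : shifted_part f n.+1 = (n + s.+1)%N :: shifted_part (fun i => f i.+1) n.
  rewrite /shifted_part -[LHS]/(mkseq _ (1 + n)) /mkseq iotaD /= f0s subn1 addnC.
  by rewrite (iotaDl 1 0) -map_comp; congr (_ :: _).
have -> : shifted_conj f n.+1 s.+1 = shifted_conj (fun i => f i.+1) n s.+1.
  apply/eq_in_map => i; rewrite mem_iota add0n leq0n /= => is_.
  by rewrite /= f0s (iotaDl 1 0) count_map is_ add1n addSn subSS.
by apply/MayaL/IHn; rewrite // -f0s; apply: fm.
Qed.

(** Geometric series in D = 1 - E. As D has no constant term, the coefficient of index n is the same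
    in all partial sums from [S n] on, so h can be read off polynomials. *)
Lemma series_inverse (F : fieldType) (E : {poly F}) : E`_0 = 1 ->
  exists h : int -> F, [/\ h 0 = 1, forall n : int, n < 0 -> h n = 0 &
    forall a : int, \sum_(i < size E) E`_i * h (a - i%:Z) = (a == 0)%:R].
Proof.
move=> E0; pose D := 1 - E; pose S M := \sum_(k < M.+1) D ^+ k.
have D0 : D`_0 = 0 by rewrite coefB coef1 E0 subrr.
have ES M : E * S M = 1 - D ^+ M.+1.
  by rewrite -[RHS]opprB subrX1 -mulNr opprB /D opprB addrC subrK.
pose h (a : int) := if a is Posz n then (S n)`_n else 0.
have hS (n M : nat) : (n <= M)%N -> h n = (S M)`_n.
  move=> nM; rewrite /h /S !coef_sum.
  apply: (sum_ord_widen (f := fun k => (D ^+ k)`_n)) => // k nk.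
  exact: coef_exp_small.
exists h; split.
- by rewrite -[h 0]/((S 0%N)`_0%N) /S big_ord1 expr0 coef1.
- by case.
- case=> [d|d]; last first.
    rewrite big1 => [//|i _]; have -> : Negz d - i%:Z = Negz (d + i) by lia.
    by rewrite mulr0.
  have Ei i : (size E <= i)%N -> E`_i = 0 by move=> ?; rewrite nth_default.
  pose f i := E`_i * h (d%:Z - i%:Z).
  have f0 i : (d < i)%N -> f i = 0.
    move=> di; have E1 : d%:Z - i%:Z = Negz (i - d.+1) by lia.
    by rewrite /f E1 mulr0.
  transitivity (\sum_(i < d.+1) f i).
    rewrite (sum_ord_widen (leq_maxr (size E) d.+1) f0).
    apply: (sum_ord_widen (f := f)); rewrite ?leq_maxl // => i iE.
    by rewrite /f (Ei _ iE) mul0r.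
  transitivity ((E * S d)`_d).
    rewrite coefM; apply: eq_bigr => -[i id] _; rewrite /f /=.
    have -> : d%:Z - i%:Z = (d - i)%N by lia.
    by rewrite -(hS (d - i)%N d) ?leq_subr.
  by rewrite ES coefB coef1 coef_exp_small // subr0; case: (d).
Qed.

(** * Passage from complete to elementary symmetric functions *)

Section DualDeterminant.
Context {F : fieldType}.
Variables (E : {poly F}) (h : int -> F).
Hypothesis E0 : E`_0 = 1.
Hypothesis h0 : h 0 = 1.
Hypothesis h_neg : forall n : int, n < 0 -> h n = 0.
Hypothesis Eh : forall a : int, \sum_(i < size E) E`_i * h (a - i%:Z) = (a == 0)%:R.

Definition coefz (p : {poly F}) (a : int) : F := if a is Posz k then p`_k else 0.

Local Notation g := (coefz E).

Lemma coefz_neg p a : a < 0 -> coefz p a = 0.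
Proof. by case: a. Qed.

Lemma toeplitz_inverse m (a c : 'I_m) :
  \sum_(d < m) h (a%:Z - d%:Z) * g (d%:Z - c%:Z) = (a == c)%:R.
Proof.
have [ac|ca] := ltnP a c.
  rewrite big1 => [|d _]; first by rewrite -val_eqE /= ltn_eqF.
  have [da|ad] := leqP d a; last by rewrite h_neg ?mul0r //; lia.
  by rewrite coefz_neg ?mulr0 //; lia.
have -> : (a == c)%:R = (a%:Z - c%:Z == 0)%:R :> F by congr _%:R; rewrite -val_eqE /=; lia.
rewrite -Eh -(big_mkord xpredT (fun d => h (a%:Z - d%:Z) * g (d%:Z - c%:Z))).
have cm : (c <= m)%N by apply/ltnW/ltn_ord.
rewrite (big_cat_nat (leq0n c) cm) /= big_nat_cond big1 ?add0r; last first.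
  by move=> d /andP[/andP[_ dc] _]; rewrite coefz_neg ?mulr0 //; lia.
rewrite -{1}[nat_of_ord c]add0n big_addn big_mkord.
have F1 (i : nat) :
    h (a%:Z - (i + c)%N%:Z) * g ((i + c)%N%:Z - c%:Z) = E`_i * h (a%:Z - c%:Z - i%:Z).
  have -> : (i + c)%N%:Z - c%:Z = i by lia.
  by rewrite mulrC; congr (_ * h _); lia.
pose M := maxn (m - c) (size E).
pose T i := E`_i * h (a%:Z - c%:Z - i%:Z).
transitivity (\sum_(i < m - c) T i); first by apply: eq_bigr => i _; apply: F1.
have am := ltn_ord a.
rewrite (sum_ord_widen (leq_maxl _ _ : (m - c <= M)%N)) => [|i ki]; last first.
  by rewrite /T h_neg ?mulr0 //; lia.
rewrite -(sum_ord_widen (leq_maxr _ _ : (size E <= M)%N)) // => i ki.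
by rewrite /T nth_default ?mul0r.
Qed.

(* dual_L = H (1 + K) and dual_M = (1 - K) H^-1 for H the Toeplitz matrix of h and
   K the square-zero matrix of c |-> 2N - 1 - c on {0, ..., N - 1}. *)
Definition dual_L N (a c : nat) : F :=
  h (a%:Z - c%:Z) + (if (c < N)%N then h (a%:Z - (2 * N)%:Z + 1 + c%:Z) else 0).

Definition dual_M N (c a : nat) : F :=
  g (c%:Z - a%:Z) - (if (N <= c)%N then g ((2 * N)%:Z - 1 - c%:Z - a%:Z) else 0).

Lemma dual_LM N m :
  (\matrix_(a < m, c < m) dual_L N a c) *m (\matrix_(c < m, a < m) dual_M N c a) = 1%:M.
Proof.
pose H : 'M[F]_m := \matrix_(a, d) h (a%:Z - d%:Z).
pose T : 'M[F]_m := \matrix_(d, c) g (d%:Z - c%:Z).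
pose K : 'M[F]_m := \matrix_(d, c) ((c < N) && (d + c == (2 * N).-1))%N%:R.
have HT : H *m T = 1%:M.
  apply/matrixP => a c; rewrite !mxE -toeplitz_inverse.
  by apply: eq_bigr => d _; rewrite !mxE.
have KK : K *m K = 0.
  apply/matrixP => a c; rewrite !mxE big1 // => d _; rewrite !mxE -natrM mulnb.
  by case: andP => // -[/andP[] /[swap] _ dN /andP[cN /eqP]]; lia.
have -> : \matrix_(a < m, c < m) dual_L N a c = H *m (1%:M + K).
  rewrite mulmxDr mulmx1; apply/matrixP => a c; rewrite !mxE; congr (_ + _).
  case: ifP => cN; last by rewrite big1 // => d _; rewrite !mxE cN mulr0.
  (* If the reflected index 2N - 1 - c lies outside the matrix, the second term is h at a negative
     argument. *)
  have [dm|dm] := ltnP ((2 * N).-1 - c) m.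
    rewrite (bigD1 (Ordinal dm)) //= big1 => [|d]; last first.
      rewrite -val_eqE /= => dd; rewrite !mxE cN /= (_ : (_ == _) = false) ?mulr0 //.
      by apply/negbTE; apply: contra dd => /eqP dd; apply/eqP; lia.
    rewrite !mxE cN /= (_ : (_ == _) = true) ?mulr1 ?addr0; last by apply/eqP; lia.
    by congr h; lia.
  rewrite h_neg ?big1 // => [d _|]; last by have := ltn_ord a; lia.
  rewrite !mxE cN /= (_ : (_ == _) = false) ?mulr0 //; have := ltn_ord d; lia.
have -> : \matrix_(c < m, a < m) dual_M N c a = (1%:M - K) *m T.
  rewrite mulmxBl mul1mx; apply/matrixP => c a; rewrite !mxE; congr (_ - _).
  case: ifP => cN; last first.
    rewrite big1 // => d _; rewrite !mxE (_ : (_ && _) = false) ?mul0r //; lia.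
  have [cN2|cN2] := ltnP c (2 * N); last first.
    rewrite coefz_neg; last by lia.
    rewrite big1 // => d _; rewrite !mxE (_ : (_ && _) = false) ?mul0r //; lia.
  have dm : ((2 * N).-1 - c < m)%N by have := ltn_ord c; lia.
  rewrite (bigD1 (Ordinal dm)) //= big1 => [|d]; last first.
    rewrite -val_eqE /= => dd; rewrite !mxE (_ : (_ && _) = false) ?mul0r //; lia.
  rewrite !mxE /= (_ : (_ && _) = true) ?mul1r ?addr0; last by lia.
  by congr (coefz E); lia.
rewrite mulmxA -(mulmxA H) mulmxDl !mulmxBr !mulmx1 mul1mx KK subr0 subrK.
by rewrite mulmx1.
Qed.

(** The matrix is lower unitriangular: on and above the diagonal, c < N forces a + c <= 2N - 2, so
    the reflected term has a negative argument. *)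
Lemma det_dual_L N m : \det (\matrix_(a < m, c < m) dual_L N a c) = 1.
Proof.
rewrite det_trig; last first.
  apply/is_trig_mxP => a c ac; rewrite mxE /dual_L h_neg ?add0r; last by lia.
  by case: ifP => // cN; rewrite h_neg //; lia.
rewrite big1 // => a _; rewrite mxE /dual_L subrr h0.
by case: ifP => [aN|_]; rewrite ?addr0 // h_neg ?addr0 //; lia.
Qed.

(** Permuting rows by a ++ a' and columns by c ++ c' moves the two minors into opposite corners,
    where [det_complement] applies; [maya_sign] evaluates the two permutations. *)
Lemma det_dual N n s (a a' c c' : seq nat) : maya (n + s) (a) a' -> maya (n + s) c c' ->
  size a = n -> size c = n ->
  \det (\matrix_(j < n, i < n) dual_L N (nth 0%N a j) (nth 0%N c i)) =
  (-1) ^+ (\sum_(k <- a') k + \sum_(k <- c') k) *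
  \det (\matrix_(j < s, i < s) dual_M N (nth 0%N c' j) (nth 0%N a' i)).
Proof.
move=> Ha Hc sa sc.
have pa := maya_perm Ha; have pc := maya_perm Hc.
set m := (n + s)%N in Ha Hc pa pc.
pose L : 'M[F]_m := \matrix_(x, y) dual_L N x y.
pose M : 'M[F]_m := \matrix_(x, y) dual_M N x y.
pose P := @seq_mx F m (a ++ a'); pose Q := @seq_mx F m (c ++ c').
have PP : P *m P^T = 1%:M by apply: seq_mx_orth.
have QQ : Q *m Q^T = 1%:M by apply: seq_mx_orth.
have QQ' : Q^T *m Q = 1%:M by apply: mulmx1C.
have seqE (u v : seq nat) (X : nat -> nat -> F) :
    perm_eq u (iota 0 m) -> perm_eq v (iota 0 m) ->
    seq_mx m u *m (\matrix_(x < m, y < m) X x y) *m (seq_mx m v)^T =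
    \matrix_(i < m, j < m) X (nth 0%N u i) (nth 0%N v j).
  move=> pu pv.
  have lt w (i : 'I_m) : perm_eq w (iota 0 m) -> (nth 0%N w i < m)%N.
    move=> pw; have sw : size w = m by rewrite (perm_size pw) size_iota.
    have := mem_nth 0%N (_ : (i < size w)%N); rewrite (perm_mem pw) mem_iota sw.
    by apply; apply: ltn_ord.
  apply/matrixP => i j; rewrite !mxE (bigD1 (Ordinal (lt v j pv))) //= big1 ?addr0.
    rewrite !mxE eqxx mulr1 (bigD1 (Ordinal (lt u i pu))) //= big1 ?addr0.
      by rewrite !mxE eqxx mul1r.
    by move=> k; rewrite -val_eqE /= => ki; rewrite !mxE eq_sym (negbTE ki) mul0r.
  move=> k; rewrite -val_eqE /= => ki.
  by rewrite [X in _ * X]mxE [X in _ * X]mxE eq_sym (negbTE ki) mulr0.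
have LM : (P *m L *m Q^T) *m (Q *m M *m P^T) = 1%:M.
  rewrite !mulmxA -(mulmxA (P *m L)) QQ' mulmx1 -(mulmxA P) dual_LM mulmx1.
  exact: PP.
have := det_complement LM.
rewrite !det_mulmx det_tr det_dual_L mulr1 !seqE //.
set X := ulsubmx _; set Y := drsubmx _.
have -> : X = \matrix_(j < n, i < n) dual_L N (nth 0%N a j) (nth 0%N c i).
  by apply/matrixP => i j; rewrite !mxE !nth_cat /= sa sc !ltn_ord.
have -> : Y = \matrix_(j < s, i < s) dual_M N (nth 0%N c' j) (nth 0%N a' i).
  by apply/matrixP => i j; rewrite !mxE !nth_cat /= sa sc !ltnNge !leq_addr /= !addKn.
move=> ->; congr (_ * _).
have Sa := @maya_sign F _ _ _ Ha; have Sc := @maya_sign F _ _ _ Hc.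
rewrite -/P in Sa; rewrite -/Q in Sc.
have Da : \det P = (-1) ^+ (\sum_(i < m) i) * (-1) ^+ (\sum_(k <- a') k).
  by rewrite -Sa -mulrA -expr2 sqrr_sign mulr1.
have Dc : \det Q = (-1) ^+ (\sum_(i < m) i) * (-1) ^+ (\sum_(k <- c') k).
  by rewrite -Sc -mulrA -expr2 sqrr_sign mulr1.
by rewrite Da Dc mulrACA -expr2 sqrr_sign mul1r exprD.
Qed.

End DualDeterminant.

(** * Vertex operators on an abstract Fock space *)

Section Fock.
Context {F : fieldType} {V : comAlgType F}.
Variables (heis : int -> V -> V) (fvar : nat -> V).
Implicit Types (u v : V) (c : F).

Hypothesis heis_lin : forall m, lin (heis m).
Hypothesis heis_vac : forall i, heis i.+1 1 = 0.
Hypothesis heis_fvar : forall i j v, heis i.+1 (fvar j * v) =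
  fvar j * heis i.+1 v + (if i == j then i.+1%:R *: v else 0).
Hypothesis fock_ind : forall Q : V -> Prop,
  Q 1 -> (forall i v, Q v -> Q (fvar i * v)) ->
  (forall c u v, Q u -> Q v -> Q (c *: u + v)) -> forall v, Q v.

(* wt_le d v: v has weight at most d, where a_{-n} has weight n, expressed by the
   vanishing of the products of annihilators of total weight larger than d. *)
Fixpoint ann_word (s : seq nat) v : V :=
  if s is i :: s' then ann_word s' (heis i.+1 v) else v.

Definition wt_le (d : int) v :=
  forall s, d < (\sum_(i <- s) i.+1)%N%:Z -> ann_word s v = 0.

Lemma ann_word_lin s : lin (ann_word s).
Proof. by elim: s => //= i s IH c u v; rewrite heis_lin IH. Qed.

(** The empty word has weight 0. This is why d is an integer: operators are shown to vanish by
    lowering the weight below 0. *)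
Lemma wt_le0 d v : d < 0 -> wt_le d v -> v = 0.
Proof. by move=> d0 /(_ [::]); apply; rewrite big_nil. Qed.

Lemma wt_le_zero d : wt_le d 0.
Proof. by move=> s _; apply/lin0/ann_word_lin. Qed.

Lemma wt_le_lin d c u v : wt_le d u -> wt_le d v -> wt_le d (c *: u + v).
Proof. by move=> ud vd s ds; rewrite ann_word_lin ud ?vd ?scaler0 ?addr0. Qed.

Lemma wt_leZ d c v : wt_le d v -> wt_le d (c *: v).
Proof. by move=> vd; rewrite -[c *: v]addr0; apply/wt_le_lin/wt_le_zero. Qed.

Lemma wt_leD d u v : wt_le d u -> wt_le d v -> wt_le d (u + v).
Proof. by move=> ud; rewrite -[u]scale1r; apply: wt_le_lin. Qed.

Lemma wt_le_trans d e v : d <= e -> wt_le d v -> wt_le e v.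
Proof. by move=> de vd s es; apply: vd; apply: le_lt_trans es. Qed.

Lemma wt_le_heis d i v : wt_le d v -> wt_le (d - i.+1%:Z) (heis i.+1 v).
Proof.
move=> vd s ds; apply: (vd (i :: s)).
by rewrite big_cons PoszD; lia.
Qed.

Lemma wt_le1 : wt_le 0 1.
Proof.
by case=> [|i s]; rewrite ?big_nil //= heis_vac => _; apply/lin0/ann_word_lin.
Qed.

Lemma wt_le_fvar d i v : wt_le d v -> wt_le (d + i.+1%:Z) (fvar i * v).
Proof.
move=> vd s; elim: s d v vd => [|j s IH] d v vd /=.
  by rewrite big_nil => dl; rewrite (wt_le0 _ vd) ?mulr0 //; lia.
rewrite big_cons PoszD => dl.
rewrite heis_fvar (linD (ann_word_lin s)) (IH _ _ (wt_le_heis vd)) ?add0r; last by lia.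
case: eqP dl => [-> dl|_ _]; last by apply/lin0/ann_word_lin.
by rewrite (linZ (ann_word_lin s)) vd ?scaler0 //; lia.
Qed.

Lemma wt_le_ex v : exists d : nat, wt_le d v.
Proof.
elim/fock_ind: v => [|i v [d vd]|c u v [d ud] [e ve]].
- by exists 0%N; apply: wt_le1.
- by exists (d + i.+1)%N; rewrite PoszD; apply: wt_le_fvar.
- by exists (maxn d e); apply: wt_le_lin; [apply: wt_le_trans ud|apply: wt_le_trans ve]; lia.
Qed.

(* [T(z), p_k] = e (z^k + z^-k) T(z) for the series T(z) of such an A. *)
Definition annihilation (e : F) (A : int -> V -> V) := [/\ forall m, lin (A m),
  forall m d v, wt_le d v -> wt_le (d - `|m|%N%:Z) (A m v),
  forall v, A 0 v = 0 &
  forall m k v, A m (fvar k * v) =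
    fvar k * A m v + (if `|m|%N == k.+1 then e *: v else 0)].

(** B(z) is e times the sum of a_{-n} z^n / n. At n = 0 the convention 1 / 0 = 0 makes the
    coefficient vanish. *)
Definition creation (e : F) (B : int -> V -> V) :=
  (forall n v, B (Negz n) v = 0) /\
  (forall (n : nat) v, B n v = (e / n%:R) *: (fvar n.-1 * v)).

Section ExpSum.
Hypothesis charF0 : [pchar F] =i pred0.

Lemma natf_neq0 n : n.+1%:R != 0 :> F.
Proof. by move/pcharf0P: charF0 => ->. Qed.

(* From [T, p] = c with c central follows [T^j / j!, p] = c T^(j-1) / (j-1)!. *)
Lemma exp_sum_commutator (d : nat) (p : V) (c : F) (u v w : nat -> V) :
  (forall j, u j = p * v j + (j%:R * c) *: w j.-1) ->
  (forall j, (d < j)%N -> v j = 0) -> (forall j, (d < j)%N -> w j = 0) ->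
  \sum_(j \in [set: nat]) j`!%:R^-1 *: u j =
  p * \sum_(j \in [set: nat]) j`!%:R^-1 *: v j +
  c *: \sum_(j \in [set: nat]) j`!%:R^-1 *: w j.
Proof.
move=> uE v0 w0.
rewrite !(@fsum_nat _ _ d.+2) => [|j dj|j dj|[|j] dj] //; last 3 first.
- by rewrite w0 ?scaler0 // ltnW.
- by rewrite v0 ?scaler0 // ltnW.
- by rewrite uE v0 ?w0 ?mulr0 ?scaler0 ?addr0 ?scaler0 // ltnW.
rewrite [X in c *: X]big_ord_recr /= w0 // scaler0 [X in c *: X]addr0.
under eq_bigr do rewrite uE scalerDr scalerA scalerAr.
rewrite big_split /= -mulr_sumr; congr (_ + _).
rewrite big_ord_recl mul0r mulr0 scale0r add0r scaler_sumr; apply: eq_bigr => j _.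
rewrite !scalerA lift0; congr (_ *: _).
by rewrite factS natrM invfM mulrACA mulVf ?natf_neq0 // mul1r mulrC.
Qed.

End ExpSum.

(** * Exponentials of annihilation series *)

Section AnnihilationExp.
Hypothesis charF0 : [pchar F] =i pred0.

Variables (A : int -> V -> V) (e : F).
Hypothesis hA : annihilation e A.

Let A_lin m : lin (A m). Proof. by case: hA. Qed.
Let A_wt m d v : wt_le d v -> wt_le (d - `|m|%N%:Z) (A m v).
Proof. by case: hA => _ + _ _; apply. Qed.
Let A0 v : A 0 v = 0. Proof. by case: hA. Qed.
Let A_fvar m k v : A m (fvar k * v) =
  fvar k * A m v + (if `|m|%N == k.+1 then e *: v else 0).
Proof. by case: hA. Qed.

(** As [A 0] vanishes, each of the j factors lowers the weight by at least 1, and their modes add up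
    to m. The bound by j makes the exponential finite, the bound by m the sums over modes. *)
Lemma pow_wt j m d v : wt_le d v ->
  wt_le (d - (maxn j `|m|%N)%:Z) (series_pow A j m v).
Proof.
elim: j m d v => [|j IH] m d v vd.
  case: m => [[|m]|m] /=; rewrite ?coef1 /= ?scale1r ?scale0r; last 2 first.
  - exact: wt_le_zero.
  - exact: wt_le_zero.
  - by rewrite maxnn subr0.
apply: fsum_ind => [|u w|p]; [exact: wt_le_zero|exact: wt_leD|].
have [->|p0] := eqVneq p 0; first by rewrite A0; apply: wt_le_zero.
by apply: (wt_le_trans _ (@A_wt _ _ _ (IH (m - p) d v vd))); lia.
Qed.

Lemma A_eq0 m (d : nat) v : wt_le d v -> (d < `|m|)%N -> A m v = 0.
Proof. by move=> vd dm; apply: (wt_le0 _ (@A_wt _ _ _ vd)); lia. Qed.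

Lemma pow_wtW j m d v : wt_le d v -> wt_le d (series_pow A j m v).
Proof. by move=> vd; apply: wt_le_trans (@pow_wt j m _ _ vd); lia. Qed.

Lemma pow_fins j (g : int -> int) v :
  fins (fun p => A p (series_pow A j (g p) v)).
Proof.
have [d vd] := wt_le_ex v; apply: (@fins_int _ _ d) => p dp.
by apply: (@A_eq0 _ d) => //; apply: pow_wtW.
Qed.

Lemma pow_lin j m : lin (series_pow A j m).
Proof.
elim: j m => [|j IH] m.
  case: m => m c u v /=; last by rewrite scaler0 addr0.
  by rewrite scalerDr !scalerA mulrC.
apply: (@fsum_lin _ _ _ _ (fun p v => A p (series_pow A j (m - p) v))) => [p c u v|v].
  by rewrite IH A_lin.
exact: pow_fins.
Qed.

Lemma powS j m v : series_pow A j.+1 m v =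
  \sum_(p \in [set: int]) A p (series_pow A j (m - p) v).
Proof. by []. Qed.

(** The commutator of A(z) with [fvar k] is the central series e (z^(k+1) + z^-(k+1)). The Leibniz
    rule gives it j times, and its two powers of z shift the mode. *)
Lemma pow_fvar j m k v : series_pow A j m (fvar k * v) =
  fvar k * series_pow A j m v +
  (j%:R * e) *: (series_pow A j.-1 (m - k.+1%:Z) v + series_pow A j.-1 (m + k.+1%:Z) v).
Proof.
elim: j m v => [|j IH] m v.
  rewrite mul0r scale0r addr0; case: m => m /=; last by rewrite mulr0.
  by rewrite scalerAr.
rewrite powS.
have E p : A p (series_pow A j (m - p) (fvar k * v)) =
   (fvar k * A p (series_pow A j (m - p) v)) +
   (e *: ((if p == k.+1%:Z then series_pow A j (m - k.+1%:Z) v else 0)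
     + (if p == - k.+1%:Z then series_pow A j (m + k.+1%:Z) v else 0))
   + (j%:R * e) *: (A p (series_pow A j.-1 (m - k.+1%:Z - p) v) +
                  A p (series_pow A j.-1 (m + k.+1%:Z - p) v))).
  rewrite IH (linD (A_lin p)) (linZ (A_lin p)) (linD (A_lin p)) A_fvar.
  rewrite -addrA; congr (_ + (_ + _ *: (A p (series_pow _ _ _ _) + A p (series_pow _ _ _ _)))).
  - have [pk|] := eqVneq `|p|%N k.+1.
      have [->|->] : p = k.+1%:Z \/ p = - k.+1%:Z by lia.
        have -> : (k.+1%:Z == - k.+1%:Z) = false by lia.
        by rewrite eqxx addr0.
      have -> : (- k.+1%:Z == k.+1%:Z) = false by lia.
      by rewrite eqxx add0r opprK.
    move=> pk; have -> : (p == k.+1%:Z) = false by lia.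
    have -> : (p == - k.+1%:Z) = false by lia.
    by rewrite addr0 scaler0.
  - by rewrite addrAC.
  - by rewrite addrAC.
under eq_fsbigr do rewrite E.
have f1 (q : int) (w : V) : fins (fun p => if p == q then w else 0).
  by exists [:: q] => p; rewrite inE => /negbTE->.
have fZ (T : choiceType) (c : F) (f : T -> V) : fins f -> fins (fun p => c *: f p).
  by move=> ff; apply: fins_sub ff _ => p ->; rewrite scaler0.
have sZ (T : choiceType) (c : F) (f : T -> V) : fins f ->
    \sum_(p \in [set: T]) c *: f p = c *: \sum_(p \in [set: T]) f p.
  by move=> ff; rewrite -(@fsum_morph _ _ _ ( *:%R c)) ?scaler0 // => *; rewrite scalerDr.
have fA j' m' := pow_fins j' (fun p => m' - p) v.
have fM : fins (fun p => fvar k * A p (series_pow A j (m - p) v)).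
  by apply: fins_sub (fA j m) _ => p ->; rewrite mulr0.
have fI := finsD (f1 k.+1%:Z (series_pow A j (m - k.+1%:Z) v))
   (f1 (- k.+1%:Z) (series_pow A j (m + k.+1%:Z) v)).
have fJ := finsD (fA j.-1 (m - k.+1%:Z)) (fA j.-1 (m + k.+1%:Z)).
rewrite fsumD //; last by apply: finsD; apply: fZ.
rewrite fsumD; [|exact: fZ|exact: fZ].
rewrite (sZ _ _ _ fI) (sZ _ _ _ fJ) (fsumD (f1 _ _) (f1 _ _)) (fsumD (fA _ _) (fA _ _)).
rewrite !fsum1 powS.
rewrite -(lin_fsum (mul_lin (fvar k))) //; congr (_ + _).
clear; case: j => [|j].
  by rewrite mul0r scale0r addr0 mul1r.
by rewrite -!powS -scalerDl -[j.+2%:R]natr1 mulrDl mul1r [e + _]addrC.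
Qed.

Lemma exp_fins m v : fins (fun j => j`!%:R^-1 *: series_pow A j m v).
Proof.
have [d vd] := wt_le_ex v; apply: (@fins_nat _ _ d) => j dj.
by rewrite (wt_le0 _ (@pow_wt j m _ _ vd)) ?scaler0 //; lia.
Qed.

Lemma exp_lin m : lin (series_exp A m).
Proof.
apply: fsum_lin => [j c u v|v]; last exact: exp_fins.
by rewrite pow_lin scalerDr !scalerA mulrC.
Qed.

Lemma exp_wt m d v : wt_le d v -> wt_le (d - `|m|%N%:Z) (series_exp A m v).
Proof.
move=> vd; apply: fsum_ind => [|u w|j]; [exact: wt_le_zero|exact: wt_leD|].
by apply: wt_leZ; apply: wt_le_trans (@pow_wt j m _ _ vd); lia.
Qed.

Lemma exp_eq0 m (d : nat) v : wt_le d v -> (d < `|m|)%N -> series_exp A m v = 0.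
Proof. by move=> vd dm; apply: (wt_le0 _ (@exp_wt m _ _ vd)); lia. Qed.

Lemma exp_fvar m k v : series_exp A m (fvar k * v) =
  fvar k * series_exp A m v +
  e *: (series_exp A (m - k.+1%:Z) v + series_exp A (m + k.+1%:Z) v).
Proof.
have [d vd] := wt_le_ex v.
have Z j n : (d < j)%N -> series_pow A j n v = 0.
  by move=> dj; apply: (wt_le0 _ (@pow_wt j n _ _ vd)); lia.
rewrite /series_exp (exp_sum_commutator charF0 (d := d)
  (w := fun j => series_pow A j (m - k.+1%:Z) v + series_pow A j (m + k.+1%:Z) v)
  (fun j => pow_fvar j m k v)).
- congr (_ + _ *: _); rewrite -fsumD; [|exact: exp_fins|exact: exp_fins].
  by apply: eq_fsbigr => j _; rewrite scalerDr.
- by move=> j dj; rewrite Z.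
- by move=> j dj; rewrite !Z ?addr0.
Qed.

Lemma exp1 m : series_exp A m 1 = (m == 0)%:R.
Proof.
have p1 j n : (0 < j)%N -> series_pow A j n 1 = 0.
  by move=> j0; apply: (wt_le0 _ (@pow_wt j n _ _ wt_le1)); lia.
rewrite /series_exp (@fsumE _ _ [:: 0%N]) // => [|[|j]]; last 2 first.
- by rewrite inE.
- by rewrite p1 ?scaler0.
rewrite big_seq1 invr1 scale1r; case: m => [[|m]|m] //=; rewrite coef1 /=.
  by rewrite scale1r.
by rewrite scale0r.
Qed.

End AnnihilationExp.

(** * Exponentials of creation series *)

Section CreationExp.
Hypothesis charF0 : [pchar F] =i pred0.

Variables (B : int -> V -> V) (e : F).
Hypothesis hB : creation e B.

Let B_neg n v : B (Negz n) v = 0. Proof. by case: hB. Qed.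
Let B_pos (n : nat) v : B n v = (e / n%:R) *: (fvar n.-1 * v).
Proof. by case: hB. Qed.

(** Truncating the creation series to a polynomial gives access to powers and derivatives of
    polynomials. *)
Definition cre_poly D : {poly V} := \poly_(i < D.+1) ((e / i%:R) *: fvar i.-1).

Lemma cre_poly0 D : (cre_poly D)`_0 = 0.
Proof. by rewrite coef_poly /= invr0 mulr0 scale0r. Qed.

Lemma cre_pow j m v : (forall n, m = Negz n -> series_pow B j m v = 0) /\
  (forall i D, m = Posz i -> (i <= D)%N ->
     series_pow B j m v = (cre_poly D ^+ j)`_i * v).
Proof.
elim: j m => [|j IH] m.
  split=> [n ->|i D -> _] //=.
  by rewrite expr0 !coef1; case: eqP; rewrite ?scale1r ?mul1r ?scale0r ?mul0r.
split=> [n mn|i D mi iD].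
  rewrite powS; apply: (@fsum_ind _ _ (eq^~ 0)) => // [u w -> ->|[p|p]];
    rewrite ?addr0 ?B_neg // B_pos.
  have [k mk] : exists k, m - p%:Z = Negz k by exists (n + p)%N; lia.
  by rewrite (proj1 (IH (m - p%:Z)) k mk) mulr0 scaler0.
rewrite powS (@fsum_Posz _ _ i.+1) => [|n|n ni]; last 2 first.
- by rewrite B_neg.
- rewrite B_pos.
  have [k mk] : exists k, m - n%:Z = Negz k by exists (n - i.+1)%N; lia.
  by rewrite (proj1 (IH (m - n%:Z)) k mk) mulr0 scaler0.
rewrite exprS coefM mulr_suml; apply: eq_bigr => -[q qi] _ /=.
rewrite B_pos (proj2 (IH (m - q%:Z)) (i - q)%N D) ?coef_poly; [|lia|lia].
by rewrite ifT ?mulrA ?scalerAl //; lia.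
Qed.

Definition cre_coef m : V := series_exp B m 1.

Lemma cre_expE m v : series_exp B m v = cre_coef m * v.
Proof.
rewrite mulrC /cre_coef /series_exp.
case: m => [i|n]; last first.
  have Z w j : series_pow B j (Negz n) w = 0.
    by apply: (proj1 (cre_pow j _ _) n).
  by rewrite !fsbig1 ?mulr0 // => j _; rewrite Z scaler0.
have Z w j : (i < j)%N -> series_pow B j i w = 0.
  by move=> ij; rewrite (proj2 (cre_pow j _ _) i i) // coef_exp_small ?mul0r ?cre_poly0.
rewrite !(@fsum_nat _ _ i.+1); last 2 first.
- by move=> j ij; rewrite (Z _ _ ij) scaler0.
- by move=> j ij; rewrite (Z _ _ ij) scaler0.
rewrite mulr_sumr; apply: eq_bigr => j _.
by rewrite !(proj2 (cre_pow j i _) i i) // mulr1 -scalerAr mulrC.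
Qed.

Lemma cre_coef_neg n : cre_coef (Negz n) = 0.
Proof.
rewrite /cre_coef /series_exp fsbig1 // => j _.
by rewrite (proj1 (cre_pow j _ _) n) ?scaler0.
Qed.

Lemma cre_coefE (i D M : nat) : (i <= D)%N -> (i <= M)%N ->
  cre_coef i = \sum_(j < M.+1) j`!%:R^-1 *: (cre_poly D ^+ j)`_i.
Proof.
move=> iD iM; rewrite /cre_coef /series_exp (@fsum_nat _ _ M.+1); last first.
  move=> j Mj; rewrite (proj2 (cre_pow j i _) i D) //.
  rewrite coef_exp_small ?cre_poly0 ?mul0r ?scaler0 //; lia.
by apply: eq_bigr => j _; rewrite (proj2 (cre_pow j i _) i D) // mulr1.
Qed.

Lemma cre_coef0 : cre_coef 0 = 1.
Proof. by rewrite (@cre_coefE 0 0 0) // big_ord1 expr0 coef1 invr1 scale1r. Qed.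

(** Coefficient i of H' = P' H for H = exp P, obtained by differentiating each P^j / j!; truncating
    P at degree i + 1 does not affect it. *)
Lemma cre_coef_newton (i : nat) : cre_coef i.+1 *+ i.+1 =
  \sum_(q < i.+1) e *: (fvar q * cre_coef (i - q)%N).
Proof.
rewrite (@cre_coefE i.+1 i.+1 i.+1) // -sumrMnl big_ord_recl expr0 coef1 scaler0 mul0rn add0r.
have E (j : 'I_i.+1) : (j.+1)`!%:R^-1 *: (cre_poly i.+1 ^+ j.+1)`_i.+1 *+ i.+1 =
   \sum_(q < i.+1) (e *: fvar q) * (j`!%:R^-1 *: (cre_poly i.+1 ^+ j)`_(i - q)).
  rewrite scalerMnr -coef_deriv deriv_exp coefMn coefM -sumrMnl scaler_sumr.
  apply: eq_bigr => q _; rewrite coef_deriv coef_poly ifT; last by case: q => q /=; lia.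
  rewrite -[_ *+ q.+1]scaler_nat scalerA [q.+1%:R * _]mulrC divfK ?natf_neq0 //.
  rewrite -scaler_nat -scalerAr !scalerA; congr (_ *: _).
  by rewrite factS natrM invfM mulrC mulrA divff ?natf_neq0 // mul1r.
under eq_bigr do rewrite lift0 E.
rewrite exchange_big; apply: eq_bigr => q _ /=.
rewrite -mulr_sumr scalerAl (@cre_coefE (i - q)%N i.+1 i) //; lia.
Qed.

End CreationExp.

Lemma mulrn_injV : [pchar F] =i pred0 ->
  forall (x y : V) n, x *+ n.+1 = y *+ n.+1 -> x = y.
Proof.
move=> charF0 x y n; rewrite -[x *+ _]scaler_nat -[y *+ _]scaler_nat.
move=> /(congr1 ( *:%R n.+1%:R^-1)).
by rewrite !scalerA mulVf ?(natf_neq0 charF0) // !scale1r.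
Qed.

(* In generating series: (1 - z w) (1 - w / z) T(z) H(w) = H(w), where T(z) acts on
   the coefficients of H(w).  T(z) H(w) satisfies Newton's recursion for the power
   sums p_k + z^k + z^-k, so twisting it by z and 1 / z gives H(w) back. *)
Lemma exp_ann_cre e A B : [pchar F] =i pred0 -> e * e = 1 ->
  annihilation e A -> creation e B -> forall m p,
  series_exp A m (cre_coef B p) - series_exp A (m - 1) (cre_coef B (p - 1))
  - series_exp A (m + 1) (cre_coef B (p - 1)) + series_exp A m (cre_coef B (p - 2)) =
  if m == 0 then cre_coef B p else 0.
Proof.
move=> charF0 ee hA hB; set P := series_exp A; set h := cre_coef B.
have Pl m : lin (P m) by apply: exp_lin hA _.
have Pf m k v : P m (fvar k * v) =
    fvar k * P m v + e *: (P (m - k.+1%:Z) v + P (m + k.+1%:Z) v).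
  exact: exp_fvar.
have hS i : h i.+1 *+ i.+1 = \sum_(q < i.+1) e *: (fvar q * h (i - q)%N).
  exact: cre_coef_newton.
(* Newton's recursion runs over families [int -> V], read as series in z; [c] and [c'] below are
   multiplication by z and 1 / z. The hypothesis e * e = 1 makes the power sums of [Q] equal to e
   p_k + z^k + z^-k. *)
pose f (i : nat) : int -> V := fun m => P m (h i).
pose Q q (x : int -> V) : int -> V :=
  fun m => e *: (fvar q * x m) + (x (m - q.+1%:Z) + x (m + q.+1%:Z)).
pose c (x : int -> V) : int -> V := fun m => x (m - 1).
pose c' (x : int -> V) : int -> V := fun m => x (m + 1).
have iterc q x m : iter q c x m = x (m - q%:Z).
  elim: q m => [|q IH] m; first by rewrite subr0.
  by rewrite iterS /c IH; congr x; lia.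
have iterc' q x m : iter q c' x m = x (m + q%:Z).
  elim: q m => [|q IH] m; first by rewrite addr0.
  by rewrite iterS /c' IH; congr x; lia.
have fctB (x y : int -> V) m : (x - y) m = x m - y m by [].
have nf : newton Q f.
  move=> i; apply/funext => m; rewrite natmulfctE fct_sumE /f /Q.
  rewrite -scaler_nat -(linZ (Pl m)) scaler_nat hS (lin_sum (Pl m)).
  apply: eq_bigr => q _; rewrite (linZ (Pl m)) Pf scalerDr scalerA ee.
  by rewrite scale1r.
have QB q : {morph Q q : x y / x - y}.
  move=> x y; apply/funext => m; rewrite fctB /Q !fctB mulrBr scalerBr.
  by rewrite -!addrA; congr (_ + _); rewrite !opprD; ring.
have cB : {morph c : x y / x - y} by [].
have Qc q x : Q q (c x) = c (Q q x).
  by apply/funext => m; rewrite /Q /c; congr (_ + (x _ + x _)); lia.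
have n1 := newton_twist QB cB Qc nf.
pose Q1 q (x : int -> V) := Q q x - iter q.+1 c x.
have Q1B q : {morph Q1 q : x y / x - y}.
  by move=> x y; apply/funext => m; rewrite /Q1 QB !(fctB, iterc); ring.
have Q1c q x : Q1 q (c' x) = c' (Q1 q x).
  apply/funext => m; rewrite /Q1 /c' !fctB !iterc /Q.
  by congr (_ + (x _ + x _) - x _); lia.
have c'B : {morph c' : x y / x - y} by [].
pose R q (x : int -> V) : int -> V := fun m => e *: (fvar q * x m).
pose g (i : nat) : int -> V := fun m => if m == 0 then h i else 0.
have n2 : newton R (twist c' (twist c f)).
  apply: (eq_newton _ (newton_twist Q1B c'B Q1c n1)) => q x.
  by apply/funext => m; rewrite fctB iterc' /Q1 fctB iterc /Q /R; ring.
have n3 : newton R g.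
  move=> i; apply/funext => m; rewrite natmulfctE fct_sumE /g /R.
  case: eqP => _; first by rewrite hS.
  by rewrite mul0rn big1 // => q _; rewrite mulr0 scaler0.
have inj (x y : int -> V) n : x *+ n.+1 = y *+ n.+1 -> x = y.
  move=> xy; apply/funext => m; apply: (mulrn_injV charF0 (n := n)).
  by move/(congr1 (@^~ m)): xy; rewrite !natmulfctE.
have h0 : h 0 = 1 by exact: cre_coef0 hB.
have f0 : twist c' (twist c f) 0%N = g 0%N.
  by apply/funext => m; rewrite /= /g /f h0 /P (exp1 hA); case: eqP.
have E i m : twist c' (twist c f) i m = g i m by rewrite (newton_uniq inj n2 n3 f0).
have hneg q : q < 0 -> h q = 0 by case: q => // n _; apply: cre_coef_neg hB _.
have P0 m : P m 0 = 0 by rewrite (lin0 (Pl m)).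
clearbody P h; move=> m [[|[|p]]|p].
- rewrite [h (_ - 1)]hneg // [h (_ - 2)]hneg // !P0 !subr0 addr0.
  exact: E 0%N m.
- rewrite [h (_ - 2)]hneg // P0 addr0.
  exact: E 1%N m.
- have -> : p.+2%:Z - 1 = p.+1 by lia.
  have -> : p.+2%:Z - 2 = p by lia.
  have := E p.+2 m; rewrite /= !fctB /c' !fctB /c /f /g => <-.
  rewrite addrK; ring.
- have hp q : q <= 0 -> h (Negz p + q) = 0 by move=> q0; apply: hneg; lia.
  by rewrite !hp ?hneg ?P0 ?subr0 ?addr0 //; case: eqP.
Qed.

(** * Vertex operators without their prefactors *)

Section HalfVertex.
Hypothesis charF0 : [pchar F] =i pred0.
Variables (e : F) (B A : int -> V -> V).
Hypotheses (hB : creation e B) (hA : annihilation (- e) A).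

(** Leaving out 1 + z and 1 - z allows U (e = 1) and U^* (e = - 1) to be treated at once. *)
Definition half_vertex : int -> V -> V := series_mul (series_exp B) (series_exp A).

Local Notation h := (cre_coef B).
Local Notation P := (series_exp A).
Local Notation W := half_vertex.

Lemma half_vertexE m v : W m v = \sum_(p \in [set: int]) h p * P (m - p) v.
Proof. by apply: eq_fsbigr => p _; apply: cre_expE hB _ _. Qed.

Lemma half_vertex_fins m v : fins (fun p => h p * P (m - p) v).
Proof.
have [d vd] := wt_le_ex v; apply: (@fins_int _ _ (d + `|m|)%N) => p dp.
by rewrite (exp_eq0 hA vd) ?mulr0 //; lia.
Qed.

Lemma half_vertex_lin m : lin (W m).
Proof.
move=> c u v; rewrite !half_vertexE.
have Pl q : lin (P q) by apply: exp_lin hA _.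
under eq_fsbigr do rewrite Pl mulrDr -scalerAr.
have fu := half_vertex_fins m u; have fv := half_vertex_fins m v.
rewrite fsumD //; last by apply: fins_sub fu _ => p E; rewrite E scaler0.
by rewrite -(@fsum_morph _ _ _ ( *:%R c)) ?scaler0 // => *; rewrite scalerDr.
Qed.

Lemma half_vertex_fvar m k v : W m (fvar k * v) =
  fvar k * W m v - e *: (W (m - k.+1%:Z) v + W (m + k.+1%:Z) v).
Proof.
rewrite !half_vertexE.
have E p : h p * P (m - p) (fvar k * v) = fvar k * (h p * P (m - p) v) -
    e *: (h p * P (m - k.+1%:Z - p) v + h p * P (m + k.+1%:Z - p) v).
  rewrite (exp_fvar charF0 hA) mulrDr mulrCA -scalerAr scaleNr mulrDr.
  have -> : m - p - k.+1%:Z = m - k.+1%:Z - p by lia.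
  by have -> : m - p + k.+1%:Z = m + k.+1%:Z - p by lia.
under eq_fsbigr do rewrite E.
have f1 := half_vertex_fins m v.
have f2 := half_vertex_fins (m - k.+1%:Z) v.
have f3 := half_vertex_fins (m + k.+1%:Z) v.
have f23 := finsD f2 f3.
rewrite fsumB; last 2 first.
- by apply: fins_sub f1 _ => p p0; rewrite p0 mulr0.
- by apply: fins_sub f23 _ => p p0; rewrite p0 scaler0.
rewrite (lin_fsum (mul_lin (fvar k)) f1) -(fsumD f2 f3); congr (_ - _).
by rewrite (@fsum_morph _ _ _ ( *:%R e)) ?scaler0 // => *; rewrite scalerDr.
Qed.

Lemma half_vertex_low (d : nat) m v : wt_le d v -> m < - d%:Z -> W m v = 0.
Proof.
move=> vd md; rewrite half_vertexE fsbig1 // => -[p|p] _; last first.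
  by rewrite (cre_coef_neg hB) mul0r.
by rewrite (exp_eq0 hA vd) ?mulr0 //; lia.
Qed.

Lemma half_vertex1 m : W m 1 = h m.
Proof.
rewrite half_vertexE -[RHS](fsum1 m); apply: eq_fsbigr => p _.
by rewrite (exp1 hA) subr_eq0 eq_sym; case: eqP => [->|_]; rewrite ?mulr1 ?mulr0.
Qed.

(** This is [exp_ann_cre] multiplied by H(z): (1 - z w) (1 - w / z) W(z) H'(w) = H(z) H'(w), the
    form that [fermion_recurrence] takes as input. *)
Lemma half_vertex_cross B' : e * e = 1 -> creation (- e) B' -> forall m p,
  W m (cre_coef B' p) - W (m - 1) (cre_coef B' (p - 1))
  - W (m + 1) (cre_coef B' (p - 1)) + W m (cre_coef B' (p - 2)) =
  h m * cre_coef B' p.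
Proof.
move=> ee hB' m p; rewrite !half_vertexE.
have fa := half_vertex_fins m (cre_coef B' p).
have fb := half_vertex_fins (m - 1) (cre_coef B' (p - 1)).
have fc := half_vertex_fins (m + 1) (cre_coef B' (p - 1)).
have fd := half_vertex_fins m (cre_coef B' (p - 2)).
have fab := finsB fa fb.
rewrite -(fsumB fa fb) -(fsumB fab fc) -(fsumD (finsB fab fc) fd).
rewrite -[RHS](fsum1 m); apply: eq_fsbigr => q _.
have -> : m - 1 - q = m - q - 1 by lia.
have -> : m + 1 - q = m - q + 1 by lia.
have ee' : - e * - e = 1 by rewrite mulrNN.
have := exp_ann_cre charF0 ee' hA hB' (m - q) p.
rewrite subr_eq0 eq_sym => X.
have R (a b c d x : V) : a * b - a * c - a * d + a * x = a * (b - c - d + x) by ring.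
rewrite R X.
by case: eqP => [->|_]; rewrite ?mulr0.
Qed.

End HalfVertex.

(** * Pairing with the dual vacuum *)

Section Dual.
Hypothesis charF0 : [pchar F] =i pred0.
Variable dual : V -> F^o.
Hypothesis dual_lin : lin dual.
Hypothesis dual_fvar : forall i v, dual (fvar i * v) = 0.

(** By Newton's recursion a nonzero multiple of the coefficient lies in the ideal generated by the
    variables. *)
Lemma dual_cre e B (i : nat) v : creation e B -> dual (cre_coef B i.+1 * v) = 0.
Proof.
move=> hB; apply: (scalerI (natf_neq0 charF0 i)); rewrite scaler0 -(linZ dual_lin).
rewrite scaler_nat -mulrnAl (cre_coef_newton charF0 hB) mulr_suml (lin_sum dual_lin).
by rewrite big1 // => q _; rewrite -scalerAl -mulrA (linZ dual_lin) dual_fvar scaler0.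
Qed.

Lemma dual_half_vertex e B A m v : creation e B -> annihilation (- e) A ->
  dual (half_vertex B A m v) = dual (series_exp A m v).
Proof.
move=> hB hA; rewrite (half_vertexE _ hB) (lin_fsum dual_lin).
  2: exact: (half_vertex_fins B hA m v).
rewrite -[RHS](fsum1 (0 : int)); apply: eq_fsbigr => -[[|p]|p] _.
- by rewrite (cre_coef0 hB) mul1r subr0.
- exact: dual_cre hB.
- by rewrite (cre_coef_neg hB) mul0r (lin0 dual_lin).
Qed.

(** The commutators with the variables involve only z^k + z^-k, which is invariant under z -> 1 /
    z. *)
Lemma exp_sym e A m v : annihilation e A -> series_exp A (- m) v = series_exp A m v.
Proof.
move=> hA; elim/fock_ind: v m => [|k v IH|c u v IHu IHv] m.
- by rewrite !(exp1 hA) oppr_eq0.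
- rewrite !(exp_fvar charF0 hA).
  have -> : - m - k.+1%:Z = - (m + k.+1%:Z) by lia.
  have -> : - m + k.+1%:Z = - (m - k.+1%:Z) by lia.
  by rewrite !IH [X in _ *: X]addrC.
- by rewrite !(exp_lin hA) IHu IHv.
Qed.

End Dual.

(** H and H' have opposite logarithmic derivatives, so z d/dz kills their product; truncation at
    degree d + 1 keeps the coefficient in question. *)
Lemma cre_conv B B' : [pchar F] =i pred0 ->
  creation 1 B -> creation (- 1) B' -> forall d : nat,
  \sum_(k < d.+1) cre_coef B k * cre_coef B' (d - k)%N = (d == 0)%:R.
Proof.
move=> charF0 hB hB' [|d].
  by rewrite big_ord1 (cre_coef0 hB) (cre_coef0 hB') mulr1.
pose H (b : int -> V -> V) : {poly V} := \poly_(k < d.+2) cre_coef b k.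
pose Q : {poly V} := \poly_(q < d.+2) fvar q.
have HD b e' : creation e' b -> forall k, (k < d.+2)%N ->
    ('X * (H b)^`())`_k = e' *: ('X * (Q * H b))`_k.
  move=> hb [|k] kd; first by rewrite !coefXM scaler0.
  rewrite !coefXM /= coef_deriv coef_poly kd (cre_coef_newton charF0 hb) coefM scaler_sumr.
  by apply: eq_bigr => -[q qk] _ /=; rewrite !coef_poly !ifT //; lia.
apply: (mulrn_injV charF0 (n := d)); rewrite mul0rn.
transitivity ((H B * H B')`_d.+1 *+ d.+1).
  rewrite coefM; congr (_ *+ _); apply: eq_bigr => -[k kd] _ /=.
  by rewrite !coef_poly !ifT //; lia.
transitivity (('X * (H B * H B')^`())`_d.+1); first by rewrite coefXM coef_deriv.
rewrite derivM mulrDr coefD.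
rewrite [X in X + _](_ : _ = ('X * (Q * H B) * H B')`_d.+1); last first.
  rewrite mulrA !coefM; apply: eq_bigr => k _.
  by rewrite (HD _ _ hB) ?scale1r //; case: k.
rewrite [X in _ + X](_ : _ = - ('X * (Q * H B') * H B)`_d.+1); last first.
  rewrite [H B * _]mulrC ['X * (_ * H B)]mulrA [LHS]coefM coefM -sumrN.
  apply: eq_bigr => k _; by rewrite (HD _ _ hB') ?scaleN1r ?mulNr //; case: k.
by rewrite -!mulrA [H B' * H B]mulrC subrr.
Qed.

(** * Clifford relations and commutation with Gamma_+ *)

Section Clifford.
Hypothesis charF0 : [pchar F] =i pred0.
Variables (B A B' A' : int -> V -> V).
Hypotheses (hB : creation 1 B) (hA : annihilation (- 1) A).
Hypotheses (hB' : creation (- 1) B') (hA' : annihilation 1 A').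

Let hA'N : annihilation (- (- 1)) A'. Proof. by rewrite opprK. Qed.

Local Notation W := (half_vertex B A).
Local Notation W' := (half_vertex B' A').
Local Notation h := (cre_coef B).
Local Notation h' := (cre_coef B').

Definition vU p v := W p v + W (p - 1) v.
Definition vUs p v := W' p v - W' (p - 1) v.

Lemma vU_lin p : lin (vU p).
Proof.
move=> c u v; rewrite /vU !(half_vertex_lin hB hA) scalerDr.
move: (c *: W p u) (c *: W (p - 1) u) (W p v) (W (p - 1) v) => x y z t; ring.
Qed.

Lemma vUs_lin p : lin (vUs p).
Proof.
move=> c u v; rewrite /vUs !(half_vertex_lin hB' hA'N) scalerBr.
move: (c *: W' p u) (c *: W' (p - 1) u) (W' p v) (W' (p - 1) v) => x y z t; ring.
Qed.

Lemma vU_fvar p k v : vU p (fvar k * v) =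
  fvar k * vU p v - (vU (p - k.+1%:Z) v + vU (p + k.+1%:Z) v).
Proof.
rewrite /vU !(half_vertex_fvar charF0 hB hA) !scale1r.
have -> : p - 1 - k.+1%:Z = p - k.+1%:Z - 1 by lia.
have -> : p - 1 + k.+1%:Z = p + k.+1%:Z - 1 by lia.
move: (fvar k) (W p v) (W (p - 1) v) (W (p - k.+1%:Z) v) (W (p + k.+1%:Z) v)
  (W (p - k.+1%:Z - 1) v) (W (p + k.+1%:Z - 1) v) => a x y z t u w; ring.
Qed.

Lemma vUs_fvar p k v : vUs p (fvar k * v) =
  fvar k * vUs p v + (vUs (p - k.+1%:Z) v + vUs (p + k.+1%:Z) v).
Proof.
rewrite /vUs !(half_vertex_fvar charF0 hB' hA'N) !scaleN1r.
have -> : p - 1 - k.+1%:Z = p - k.+1%:Z - 1 by lia.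
have -> : p - 1 + k.+1%:Z = p + k.+1%:Z - 1 by lia.
move: (fvar k) (W' p v) (W' (p - 1) v) (W' (p - k.+1%:Z) v) (W' (p + k.+1%:Z) v)
  (W' (p - k.+1%:Z - 1) v) (W' (p + k.+1%:Z - 1) v) => a x y z t u w; ring.
Qed.

Lemma cre_neg e b m : creation e b -> m < 0 -> cre_coef b m = 0.
Proof. by move=> hb; case: m => // n _; apply: cre_coef_neg hb _. Qed.

Lemma vU1 p : vU p 1 = h p + h (p - 1).
Proof. by rewrite /vU !(half_vertex1 hB hA). Qed.

Lemma vUs1 p : vUs p 1 = h' p - h' (p - 1).
Proof. by rewrite /vUs !(half_vertex1 hB' hA'N). Qed.

(** On the vacuum the inner operator becomes a series coefficient. The two orders of the product
    then give the families a and b of [fermion_recurrence], whose conclusion restores the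
    prefactors. *)
Lemma clifford1 m p :
  vUs m (vU p 1) + vU (p + 1) (vUs (m - 1) 1) = (m + p == 0)%:R.
Proof.
rewrite vU1 vUs1 (linD (vUs_lin m)) (linB (vU_lin _)).
pose a m p := W' m (h p); pose b m p := W p (h' m).
have W0 q : W q 0 = 0 by exact: (lin0 (half_vertex_lin hB hA q)).
have W'0 q : W' q 0 = 0 by exact: (lin0 (half_vertex_lin hB' hA'N q)).
have NN : - 1 * - 1 = 1 :> F by rewrite mulrNN mulr1.
have E := @fermion_recurrence V a b h h'.
rewrite -E.
- rewrite /vU /vUs -/(a _ _) /a /b.
  have -> : p + 1 - 1 = p by lia.
  have -> : p - 1 + 1 = p by lia.
  move: (W' m (h p)) (W' m (h (p - 1))) (W' (m - 1) (h p)) (W' (m - 1) (h (p - 1)))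
   (W (p + 1) (h' (m - 1))) (W (p + 1) (h' (m - 1 - 1))) (W p (h' (m - 1)))
   (W p (h' (m - 1 - 1))) => x1 x2 x3 x4 x5 x6 x7 x8; ring.
- exact: cre_coef_neg hB.
- exact: cre_coef_neg hB'.
- by move=> i j j0; rewrite /a (cre_neg hB j0) W'0.
- by move=> i j j0; rewrite /b (cre_neg hB' j0) W0.
- by move=> i j; apply: (half_vertex_cross charF0 hB' hA'N NN); rewrite opprK.
- move=> i j; rewrite -(half_vertex_cross charF0 hB hA (mulr1 1) hB' j i) /b.
  by rewrite addrAC.
- exact: cre_conv.
Qed.

(* The commutators with multiplication by fvar k reduce the identity to v = 1. *)
Lemma clifford m p v :
  vUs m (vU p v) + vU (p + 1) (vUs (m - 1) v) = (m + p == 0)%:R *: v.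
Proof.
elim/fock_ind: v m p => [|k v IH|c u v IHu IHv] m p.
- by rewrite clifford1; case: eqP; rewrite ?scale1r ?scale0r.
- rewrite vU_fvar vUs_fvar (linB (vUs_lin m)) (linD (vUs_lin m)).
  rewrite (linD (vU_lin _)) (linD (vU_lin _)).
  rewrite vU_fvar vUs_fvar.
  have I1 := IH m p; have I2 := IH (m - k.+1%:Z) p; have I3 := IH (m + k.+1%:Z) p.
  have I4 := IH m (p - k.+1%:Z); have I5 := IH m (p + k.+1%:Z).
  rewrite scalerAr -I1.
  have X : (m - k.+1%:Z + p == 0) = (m + (p - k.+1%:Z) == 0) by congr (_ == _); lia.
  have Y : (m + k.+1%:Z + p == 0) = (m + (p + k.+1%:Z) == 0) by congr (_ == _); lia.
  rewrite X -I4 in I2; rewrite Y -I5 in I3.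
  move: I2 I3 {I1 I4 I5 X Y IH}.
  have -> : p + 1 - k.+1%:Z = p - k.+1%:Z + 1 by lia.
  have -> : p + 1 + k.+1%:Z = p + k.+1%:Z + 1 by lia.
  have -> : m - 1 - k.+1%:Z = m - k.+1%:Z - 1 by lia.
  have -> : m - 1 + k.+1%:Z = m + k.+1%:Z - 1 by lia.
  move: (fvar k) (vUs m (vU p v)) (vUs (m - k.+1%:Z) (vU p v)) (vUs (m + k.+1%:Z) (vU p v))
   (vUs m (vU (p - k.+1%:Z) v)) (vUs m (vU (p + k.+1%:Z) v))
   (vU (p + 1) (vUs (m - 1) v)) (vU (p + 1) (vUs (m - k.+1%:Z - 1) v))
   (vU (p + 1) (vUs (m + k.+1%:Z - 1) v))
   (vU (p - k.+1%:Z + 1) (vUs (m - 1) v)) (vU (p + k.+1%:Z + 1) (vUs (m - 1) v)).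
  move=> f x1 x2 x3 x4 x5 y1 y2 y3 y4 y5 I2 I3.
  rewrite -[x2](addrK y2) I2 -[x3](addrK y3) I3; ring.
- rewrite !(vU_lin, vUs_lin) [RHS]scalerDr [_ *: (c *: u)]scalerA [_%:R * c]mulrC.
  rewrite -scalerA -IHu -IHv.
  rewrite (scalerDr c (vUs m (vU p u)) (vU (p + 1) (vUs (m - 1) u))).
  move: (c *: vUs m (vU p u)) (c *: vU (p + 1) (vUs (m - 1) u)) (vUs m (vU p v))
    (vU (p + 1) (vUs (m - 1) v)) => x y z t; ring.
Qed.

Lemma vUs_vac p : p <= 0 -> vUs p 1 = (p == 0)%:R.
Proof.
move=> p0; rewrite vUs1 [h' (p - 1)](cre_neg hB') ?subr0; last by lia.
case: eqP => [->|pn]; first exact: cre_coef0 hB'.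
by rewrite (cre_neg hB') //; lia.
Qed.

Lemma vUs_low v : exists d : nat, forall m, m < - d%:Z -> vUs m v = 0.
Proof.
have [d vd] := wt_le_ex v; exists d => m md.
by rewrite /vUs !(half_vertex_low hB' hA'N vd) ?subrr //; lia.
Qed.

(** Only (1 - z) T(z) survives under the dual vacuum; T(z) is invariant under z -> 1 / z, and 1 - 1
    / z = - (1 - z) / z. *)
Lemma dual_vUs (dual : V -> F^o) : lin dual -> (forall i v, dual (fvar i * v) = 0) ->
  forall m v, dual (vUs (m + 1) v) = - dual (vUs (- m) v).
Proof.
move=> dl df m v; rewrite /vUs !(linB dl) !(dual_half_vertex charF0 dl df _ _ hB' hA'N).
have -> : - m - 1 = - (m + 1) by lia.
by rewrite addrK !(exp_sym charF0 _ _ hA') opprB.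
Qed.

Section Gamma.
Variables (G : V -> V) (c : F).
Hypotheses (G_lin : lin G) (G1 : G 1 = 1).
Hypothesis G_fvar : forall k v, G (fvar k * v) = fvar k * G v + c ^+ k.+1 *: G v.

(** G shifts the variable of index k by c^(k+1), so G H' satisfies Newton's recursion of the twist
    of H' by c. *)
Lemma Gamma_cre m : G (h' m) = h' m - c *: h' (m - 1).
Proof.
have G0 : G 0 = 0 by apply: lin0.
case: m => [i|n]; last first.
  by rewrite !(cre_neg hB') ?scaler0 ?subrr //; lia.
pose f (i : nat) := G (h' i).
pose Q q (x : V) := - (fvar q * x).
pose Q' q (x : V) := Q q x - iter q.+1 ( *:%R c) x.
have itc q (x : V) : iter q ( *:%R c) x = c ^+ q *: x.
  by elim: q => [|q IH]; rewrite ?expr0 ?scale1r // iterS IH scalerA exprS.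
have nh : newton Q (fun i : nat => h' i).
  by move=> j; rewrite (cre_coef_newton charF0 hB'); apply: eq_bigr => q _; rewrite scaleN1r.
have nf : newton Q' f.
  move=> j; rewrite /f -scaler_nat -(linZ G_lin) scaler_nat (cre_coef_newton charF0 hB').
  rewrite (lin_sum G_lin); apply: eq_bigr => q _.
  by rewrite (linZ G_lin) G_fvar scaleN1r opprD /Q' itc.
have QB q : {morph Q q : x y / x - y} by move=> x y; rewrite /Q mulrBr opprB opprK addrC.
have cB : {morph ( *:%R c : V -> V) : x y / x - y} by move=> x y; rewrite scalerBr.
have Qc q (x : V) : Q q (c *: x) = c *: Q q x by rewrite /Q scalerN scalerAr.
have nt := newton_twist QB cB Qc nh.
have E := newton_uniq (mulrn_injV charF0) nf nt _ i.
rewrite -/(f i) E; last by rewrite /= /f (cre_coef0 hB') G1.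
case: i {E} => [|i] /=; first by rewrite [h' (_ - 1)](cre_neg hB') ?scaler0 ?subr0.
by have -> : i.+1%:Z - 1 = i by lia.
Qed.

Lemma Gamma_half_vertex m v : G (W' m v) = W' m (G v) - c *: W' (m - 1) (G v).
Proof.
elim/fock_ind: v m => [|k v IH|a u v IHu IHv] m.
- by rewrite G1 !(half_vertex1 hB' hA'N) Gamma_cre.
- rewrite G_fvar !(linD (half_vertex_lin hB' hA'N _)) !(linZ (half_vertex_lin hB' hA'N _)).
  rewrite !(half_vertex_fvar charF0 hB' hA'N) !scaleN1r !opprK !(linD G_lin) G_fvar !IH.
  have -> : m - 1 - k.+1%:Z = m - k.+1%:Z - 1 by lia.
  have -> : m - 1 + k.+1%:Z = m + k.+1%:Z - 1 by lia.
  rewrite !scalerDr !scalerN !scalerA [c ^+ _ * c]mulrC scalerAr.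
  move: (fvar k) (c ^+ k.+1 *: W' m (G v)) (W' m (G v)) (c *: W' (m - 1) (G v))
    (W' (m - k.+1%:Z) (G v)) (W' (m + k.+1%:Z) (G v)).
  move: (c *: W' (m - k.+1%:Z - 1) (G v)) (c *: W' (m + k.+1%:Z - 1) (G v)).
  move: ((c * c ^+ k.+1) *: W' (m - 1) (G v)) => x1 x2 x3 x4 x5 x6 x7 x8 x9; ring.
- rewrite !(half_vertex_lin hB' hA'N) !G_lin !(half_vertex_lin hB' hA'N) IHu IHv.
  rewrite !scalerBr !scalerDr !scalerA [a * c]mulrC.
  move: (a *: W' m (G u)) ((c * a) *: W' (m - 1) (G u)) (W' m (G v))
    (c *: W' (m - 1) (G v)) => x y z t; ring.
Qed.

Lemma Gamma_vUs m v : G (vUs m v) = vUs m (G v) - c *: vUs (m - 1) (G v).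
Proof.
rewrite /vUs (linB G_lin) !Gamma_half_vertex scalerBr.
move: (c *: W' (m - 1) (G v)) (c *: W' (m - 1 - 1) (G v)) (W' m (G v))
  (W' (m - 1) (G v)) => x y z t; ring.
Qed.

End Gamma.

End Clifford.

(** * Linearity and commutators of Gamma_+ *)

Section GammaOperators.
Hypothesis charF0 : [pchar F] =i pred0.
Variable c : F.

Local Notation L := (Gamma_log heis c).

Lemma Gamma_logE v : L v = \sum_(n \in [set: nat]) (c ^+ n / n%:R) *: heis n v.
Proof.
apply: fsbig_widen => // -[|n] [_ /=]; last by case.
by rewrite invr0 mulr0 scale0r.
Qed.

Lemma heis_eq0 (d n : nat) v : wt_le d v -> (d < n)%N -> heis n v = 0.
Proof. by case: n => // n vd dn; apply: (wt_le0 _ (@wt_le_heis _ n _ vd)); lia. Qed.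

Lemma Gamma_log_fins v : fins (fun n => (c ^+ n / n%:R) *: heis n v).
Proof.
have [d vd] := wt_le_ex v; apply: (@fins_nat _ _ d) => n dn.
by rewrite (heis_eq0 vd dn) scaler0.
Qed.

Lemma Gamma_log_lin : lin L.
Proof.
move=> a u v; rewrite !Gamma_logE.
apply: (@fsum_lin _ _ _ _ (fun n v => (c ^+ n / n%:R) *: heis n v)) => [n b w z|w].
  by rewrite heis_lin scalerDr !scalerA mulrC.
exact: Gamma_log_fins.
Qed.

Lemma Gamma_log_fvar k v : L (fvar k * v) = fvar k * L v + c ^+ k.+1 *: v.
Proof.
rewrite !Gamma_logE (lin_fsum (mul_lin (fvar k))); last exact: Gamma_log_fins.
rewrite -[X in _ + X](fsum1 k.+1) -fsumD; last 2 first.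
- by apply: fins_sub (Gamma_log_fins v) _ => n n0; rewrite n0 mulr0.
- by exists [:: k.+1] => n; rewrite inE => /negbTE->.
apply: eq_fsbigr => -[|n] _; first by rewrite invr0 mulr0 !scale0r mulr0 addr0.
rewrite heis_fvar scalerDr scalerAr eqSS; congr (_ + _).
by case: eqP => [->|_]; rewrite ?scaler0 // scalerA divfK ?natf_neq0.
Qed.

Lemma Gamma_log_wt d v : wt_le d v -> wt_le (d - 1) (L v).
Proof.
move=> vd; rewrite Gamma_logE.
apply: fsum_ind => [|u w|[|n]]; [exact: wt_le_zero|exact: wt_leD| |].
  by rewrite invr0 mulr0 scale0r; apply: wt_le_zero.
by apply: wt_leZ; apply: wt_le_trans (@wt_le_heis _ n _ vd); lia.
Qed.

Lemma Gamma_iter_wt j d v : wt_le d v -> wt_le (d - j%:Z) (iter j L v).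
Proof.
elim: j => [|j IH] vd /=; first by rewrite subr0.
by apply: wt_le_trans (Gamma_log_wt (IH vd)); lia.
Qed.

Lemma Gamma_iter_eq0 j (d : nat) v : wt_le d v -> (d < j)%N -> iter j L v = 0.
Proof. by move=> vd dj; apply: (wt_le0 _ (@Gamma_iter_wt j _ _ vd)); lia. Qed.

Lemma Gamma_iter_lin j : lin (iter j L).
Proof. by elim: j => // j IH a u v; rewrite !iterS IH Gamma_log_lin. Qed.

Lemma Gamma_iter_fvar j k v : iter j L (fvar k * v) =
  fvar k * iter j L v + (j%:R * c ^+ k.+1) *: iter j.-1 L v.
Proof.
elim: j => [|j IH]; first by rewrite mul0r scale0r addr0.
rewrite iterS IH (linD Gamma_log_lin) (linZ Gamma_log_lin) Gamma_log_fvar -addrA.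
congr (_ + _).
case: j {IH} => [|j]; first by rewrite mul0r scale0r addr0 mul1r.
by rewrite -iterS -scalerDl -[j.+2%:R]natr1 mulrDl mul1r [X in X *: _]addrC.
Qed.

Lemma Gamma_fins v : fins (fun j => j`!%:R^-1 *: iter j L v).
Proof.
have [d vd] := wt_le_ex v; apply: (@fins_nat _ _ d) => j dj.
by rewrite (Gamma_iter_eq0 vd dj) scaler0.
Qed.

Lemma Gamma_plus_lin : lin (Gamma_plus heis c).
Proof.
apply: (@fsum_lin _ _ _ _ (fun j v => j`!%:R^-1 *: iter j L v)) => [j a u v|v].
  by rewrite Gamma_iter_lin scalerDr !scalerA mulrC.
exact: Gamma_fins.
Qed.

Lemma Gamma_plus1 : Gamma_plus heis c 1 = 1.
Proof.
rewrite /Gamma_plus (@fsum_nat _ _ 1) => [|j j0].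
  by rewrite big_ord1 invr1 scale1r.
by rewrite (Gamma_iter_eq0 wt_le1 j0) scaler0.
Qed.

Lemma Gamma_plus_fvar k v : Gamma_plus heis c (fvar k * v) =
  fvar k * Gamma_plus heis c v + c ^+ k.+1 *: Gamma_plus heis c v.
Proof.
have [d vd] := wt_le_ex v.
apply: (exp_sum_commutator charF0 (d := d) (fun j => Gamma_iter_fvar j k v)) => j.
  exact: Gamma_iter_eq0.
exact: Gamma_iter_eq0.
Qed.

End GammaOperators.

Section Instances.
Hypothesis charF0 : [pchar F] =i pred0.
Hypothesis heis_Negz : forall n v, heis (Negz n) v = fvar n * v.

Lemma creation_cre : creation 1 (cre_series heis).
Proof.
split=> // -[|n] v; first by rewrite invr0 mulr0 scale0r.
by rewrite /cre_series heis_Negz mul1r.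
Qed.

Lemma creation_cre_opp : creation (- 1) (series_opp (cre_series heis)).
Proof.
have [c1 c2] := creation_cre.
split=> n v; rewrite /series_opp ?c1 ?oppr0 //.
by rewrite c2 mulNr scaleNr.
Qed.

Lemma annihilation_ann : annihilation 1 (ann_series heis).
Proof.
have Z m : (m == 0 :> int) = false -> exists n, absz m = n.+1.
  by move=> m0; exists (absz m).-1; lia.
split=> [m c u v|m d v vd|v|m k v]; rewrite /ann_series ?eqxx //.
- by case: ifP => _; rewrite ?scaler0 ?addr0 // heis_lin scalerDr !scalerA mulrC.
- case: ifP => [_|/Z[n ->]]; first exact: wt_le_zero.
  exact/wt_leZ/wt_le_heis.
- case: ifP => [/eqP->|/Z[n ->]]; first by rewrite mulr0 addr0.
  rewrite heis_fvar scalerDr scalerAr eqSS; congr (_ + _).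
  by case: eqP => [->|_]; rewrite ?scaler0 // scalerA mulVf ?natf_neq0.
Qed.

Lemma annihilation_ann_opp : annihilation (- 1) (series_opp (ann_series heis)).
Proof.
have [l w z f] := annihilation_ann; rewrite /series_opp.
split=> [m c u v|m d v vd|v|m k v].
- by rewrite l opprD scalerN.
- by rewrite -scaleN1r; apply/wt_leZ/w.
- by rewrite z oppr0.
- by rewrite f opprD mulrN; case: eqP => _; rewrite ?oppr0 // scale1r scaleN1r.
Qed.

Lemma series_mul_1X (e : F) (A : int -> V -> V) m v :
  series_mul (poly_series (1 + e *: 'X)) A m v = A m v + e *: A (m - 1) v.
Proof.
rewrite /series_mul (@fsum_Posz _ _ 2) => [|n //|[|[|n]] _ //]; last first.
  by rewrite /= coefD coef1 coefZ coefX /= mulr0 addr0 scale0r.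
rewrite big_ord_recl big_ord1 /= !coefD !coef1 !coefZ !coefX /= mulr0 mulr1 addr0 add0r.
by rewrite scale1r subr0.
Qed.

Notation cre := (cre_series heis).
Notation ann := (ann_series heis).

Lemma U_seriesE m v : U_series heis m v = vU cre (series_opp ann) m v.
Proof.
by have := series_mul_1X 1 (half_vertex cre (series_opp ann)) m v; rewrite !scale1r.
Qed.

Lemma Ustar_seriesE m v : Ustar_series heis m v = vUs (series_opp cre) ann m v.
Proof.
by have := series_mul_1X (- 1) (half_vertex (series_opp cre) ann) m v; rewrite !scaleN1r.
Qed.

End Instances.

Section PolyAction.
Implicit Types (p : {poly F}) (f : nat -> V).

Lemma poly_sum_widen p f M : (size p <= M)%N ->
  \sum_(i < size p) p`_i *: f i = \sum_(i < M) p`_i *: f i.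
Proof.
move=> pM; apply: (sum_ord_widen (f := fun i => p`_i *: f i)) => // i pi.
by rewrite nth_default ?scale0r.
Qed.

Lemma poly_sum_linear c p f :
  \sum_(i < size ((1 - c *: 'X) * p)) ((1 - c *: 'X) * p)`_i *: f i =
  \sum_(i < size p) p`_i *: (f i - c *: f i.+1).
Proof.
set q := (1 - c *: 'X) * p.
have qE i : q`_i.+1 = p`_i.+1 - c * p`_i.
  by rewrite /q mulrBl mul1r coefB -scalerAl coefZ coefXM.
have q0 : q`_0%N = p`_0%N.
  by rewrite /q mulrBl mul1r coefB -scalerAl coefZ coefXM mulr0 subr0.
have sq : (size q <= (size p).+1)%N.
  apply/leq_sizeP => -[|j] //; rewrite ltnS => pj.
  by rewrite qE !nth_default ?mulr0 ?subr0 // ltnW.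
rewrite (poly_sum_widen _ sq) big_ord_recl q0.
have -> : \sum_(i < size p) p`_i *: (f i - c *: f i.+1) =
    \sum_(i < size p) p`_i *: f i - \sum_(i < size p) (c * p`_i) *: f i.+1.
  by rewrite -sumrB; apply: eq_bigr => i _; rewrite scalerBr scalerA mulrC.
rewrite [X in _ = X - _](poly_sum_widen _ (leqnSn _)) big_ord_recl -addrA; congr (_ + _).
by rewrite -sumrB; apply: eq_bigr => i _; rewrite lift0 qE scalerBl.
Qed.

End PolyAction.

Fixpoint shift_part (lam : seq nat) : seq int :=
  if lam is p :: lam' then (p + size lam')%N%:Z :: shift_part lam' else [::].

Lemma size_shift_part lam : size (shift_part lam) = size lam.
Proof. by elim: lam => //= p lam ->. Qed.

Lemma nth_shift_part lam j : (j < size lam)%N ->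
  nth 0 (shift_part lam) j = (nth 0%N lam j + (size lam - j.+1))%N%:Z.
Proof. by elim: lam j => [|p lam IH] [|j] //= jn; rewrite ?subn1 ?IH. Qed.

Section Character.
Hypothesis charF0 : [pchar F] =i pred0.
Hypothesis heis_Negz : forall n v, heis (Negz n) v = fvar n * v.
Variable dual : V -> F^o.
Hypotheses (dual_lin : lin dual) (dual1 : dual 1 = 1).
Hypothesis dual_fvar : forall i v, dual (fvar i * v) = 0.
Variables (N : nat) (x : 'I_N -> F).

Local Notation U := (U_series heis).
Local Notation Us := (Ustar_series heis).

Let cB := creation_cre heis_Negz.
Let cA := annihilation_ann_opp charF0.
Let cB' := creation_cre_opp heis_Negz.
Let cA' := annihilation_ann charF0.

(* The generating polynomial of the (-1)^i e_i(x^pm). *)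
Definition char_poly_pm : {poly F} :=
  \prod_(i < N) ((1 - x i *: 'X) * (1 - (x i)^-1 *: 'X)).

Definition intertwines (p : {poly F}) (G : V -> V) := [/\ lin G, G 1 = 1 &
  forall m v, G (Us m v) = \sum_(i < size p) p`_i *: Us (m - i%:Z) (G v)].

Lemma Gamma_Us c m v : Gamma_plus heis c (Us m v) =
  Us m (Gamma_plus heis c v) - c *: Us (m - 1) (Gamma_plus heis c v).
Proof.
rewrite !Ustar_seriesE.
apply: (Gamma_vUs charF0 cB' cA' (Gamma_plus_lin c) (Gamma_plus1 c)).
exact: Gamma_plus_fvar.
Qed.

Lemma intertwinesS c p G : intertwines p G ->
  intertwines ((1 - c *: 'X) * p) (Gamma_plus heis c \o G).
Proof.
case=> Gl G1 GU; split=> [a u v|/=|m v /=].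
- by rewrite /= Gl Gamma_plus_lin.
- by rewrite G1 Gamma_plus1.
rewrite GU (poly_sum_linear c p (fun i => Us (m - i%:Z) (Gamma_plus heis c (G v)))).
rewrite (lin_sum (Gamma_plus_lin c)); apply: eq_bigr => i _.
rewrite (linZ (Gamma_plus_lin c)) Gamma_Us.
by have -> : m - i%:Z - 1 = m - i.+1%:Z by lia.
Qed.

Lemma intertwines_pm : intertwines char_poly_pm (Gamma_plus_pm heis x).
Proof.
rewrite /char_poly_pm /Gamma_plus_pm.
elim/big_rec2: _ => [|i p G _ GP].
  split=> // m v; rewrite size_poly1 big_ord1 coef1 scale1r subr0 //.
rewrite -mulrA; exact/intertwinesS/intertwinesS.
Qed.

Lemma so_ketE lam : so_ket heis 1 lam = ket U 1 (shift_part lam).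
Proof.
elim: lam => //= p lam ->; rewrite /U_mode opprK size_shift_part.
by have -> : (p + size lam)%N%:Z - (size lam)%:Z = p%:Z by lia.
Qed.

Lemma so_bra_ket (h : int -> F) mu lam : char_poly_pm`_0 = 1 ->
  (forall n : int, n < 0 -> h n = 0) ->
  (forall a : int, \sum_(i < size char_poly_pm) char_poly_pm`_i * h (a - i%:Z) =
    (a == 0)%:R) ->
  size lam = (size mu + N)%N ->
  so_bra heis dual mu (Gamma_plus_pm heis x (so_ket heis 1 lam)) =
  \det (\matrix_(j < size mu + N, i < size mu + N)
    col_fun h mu N i (nth 0 (shift_part lam) j)).
Proof.
move=> E0 hn Eh sz; have [Gl G1 GU] := intertwines_pm.
rewrite so_ketE /so_bra /Ustar_mode.
have Ue m v : U m v = vU (cre_series heis) (series_opp (ann_series heis)) m v.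
  exact: U_seriesE.
have Use m v : Us m v = vUs (series_opp (cre_series heis)) (ann_series heis) m v.
  exact: Ustar_seriesE.
apply: (@matrix_coef F V U Us (Gamma_plus_pm heis x) 1 dual _ _ _ _ _ _ char_poly_pm h).
- by move=> m a u v; rewrite !Ue (vU_lin cB cA).
- by move=> m a u v; rewrite !Use (vUs_lin cB' cA').
- exact: Gl.
- by move=> m p v; rewrite !(Ue, Use) (clifford charF0 cB cA cB' cA').
- by move=> m m0; rewrite Use (vUs_vac cB' cA') //; case: eqP; rewrite ?scale1r ?scale0r.
- move=> v; have [d vd] := vUs_low cB' cA' v.
  by exists d => m md; rewrite Use vd.
- exact: E0.
- exact: hn.
- exact: Eh.
- exact: GU.
- exact: dual_lin.
- exact: dual1.
- exact: G1.
- by move=> m v; rewrite !Use (dual_vUs charF0 cB' cA' dual_lin).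
- by rewrite size_shift_part.
Qed.

End Character.

End Fock.

(** * The determinant formula *)

Local Opaque fderiv.

Section FockInstance.
Context {F : fieldType}.
Local Notation V := (fock F).
Implicit Types (u v : V) (c : F).

Lemma fock_induction (Q : V -> Prop) :
  Q 1 -> (forall i v, Q v -> Q (fvar i * v)) ->
  (forall c u v, Q u -> Q v -> Q (c *: u + v)) -> forall v, Q v.
Proof.
move=> Q1 QM QL.
have Q0 : Q 0 by rewrite -(addNr 1) -scaleN1r; apply: QL.
have Qk d (k : {cmonom nat}) : mdeg k = d -> Q << k >>.
  elim: d k => [|d IH] k; first by move=> /mdeg_eq0I->.
  move=> kd; have [i ki] : exists i, (0 < k i)%N.
    case: (fset_0Vmem (finsupp k)) => [k0|[i]]; last first.
      by rewrite -cmE_neq0 -lt0n; exists i.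
    by move: kd; rewrite mdegE k0 big_nil.
  have kE : k = mmul (ucm i) (divcm k (ucm i)).
    apply/eqP/cmP => j; rewrite cmM divcmE ucmE.
    by case: eqVneq => [<-|_]; rewrite ?subn0 // subnKC.
  have -> : (<< k >> : V) = fvar i * << divcm k (ucm i) >>.
    by rewrite /fvar malgM_def fgmulUU mulr1 -kE.
  by apply/QM/IH; move: kd; rewrite {1}kE mdegM mdegU => -[].
move=> v; rewrite (monalgE v); elim/big_rec: _ => // k w _ Qw.
have -> : (<< v@_k *g k >> : V) = v@_k *: << k >>.
  apply/malgP => j; rewrite mcoeffZ [LHS]mcoeffU [X in _ * X]mcoeffU.
  by case: (k == j); rewrite ?mulr1 ?mulr0 ?mulr0n.
exact: QL (Qk _ k erefl) Qw.
Qed.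

Lemma fderiv_lin i : lin (@fderiv F i).
Proof.
move=> c u v; apply: (proj1 (malgP _ _)) => k.
rewrite [LHS]mcoeff_fderiv [X in X *+ _]mcoeffD [X in (X + _) *+ _]mcoeffZ.
rewrite [RHS]mcoeffD [X in _ = X + _]mcoeffZ.
rewrite [X in _ = _ * X + _]mcoeff_fderiv [X in _ = _ + X]mcoeff_fderiv.
by rewrite mulrnDl mulrnAr.
Qed.

Lemma fock_heis_lin m : lin (@heis F m).
Proof.
case: m => [[|i]|i]; [|exact: (lin_scale i.+1%:R (fderiv_lin i))|exact: (mul_lin (fvar i))].
by move=> c u v; rewrite /heis scaler0 addr0.
Qed.

Lemma fock_heis_fvar i j v : heis i.+1 (fvar j * v) =
  fvar j * heis i.+1 v + (if i == j then i.+1%:R *: v else 0).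
Proof. by rewrite /heis fderiv_fvarM scale_commutator. Qed.

Lemma dual_vac_lin : lin (@dual_vac F : V -> F^o).
Proof. by move=> c u v; rewrite /dual_vac mcoeffD mcoeffZ. Qed.

Lemma dual_vac_fvar i v : dual_vac (fvar i * v) = 0.
Proof. exact: (dual_vac_heis i v). Qed.

End FockInstance.

Section ElementarySymmetric.
Context {F : fieldType} {N : nat}.
Variable x : 'I_N -> F.

Lemma coef_linearM (c : F) (p : {poly F}) n :
  ((1 + c *: 'X) * p)`_n = p`_n + (if n is k.+1 then c * p`_k else 0).
Proof.
by rewrite mulrDl mul1r coefD -scalerAl coefZ coefXM; case: n => //=; rewrite mulr0.
Qed.

Lemma char_poly_pm_sign n : (char_poly_pm x)`_n = (-1) ^+ n * elem_pm x n.
Proof.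
rewrite /char_poly_pm /elem_pm; elim/big_rec2: _ n => [|i p q _ IH] n.
  by rewrite coef1; case: n => [|n]; rewrite ?mul1r ?mulr0.
have step c (p' q' : {poly F}) : (forall n, q'`_n = (-1) ^+ n * p'`_n) ->
    forall n, ((1 - c *: 'X) * q')`_n = (-1) ^+ n * ((1 + c *: 'X) * p')`_n.
  move=> H [|m]; rewrite -scaleNr !coef_linearM !H ?addr0 // mulrDr; congr (_ + _).
  by rewrite exprS !mulNr mul1r mulrCA.
by rewrite -!mulrA; apply/step/step/IH.
Qed.

Lemma elem_pm0 : elem_pm x 0 = 1.
Proof.
rewrite -[elem_pm x 0]/((\prod_(i < N) ((1 + x i *: 'X) * (1 + (x i)^-1 *: 'X)))`_0%N).
elim/big_rec: _ => [|i p _ IH]; first by rewrite coef1.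
by rewrite -mulrA !coef_linearM !addr0.
Qed.

Lemma coefz_char_poly_pm a : coefz (char_poly_pm x) a = (-1) ^+ absz a * elem_pm x a.
Proof. by case: a => n; rewrite /coefz ?char_poly_pm_sign ?mulr0. Qed.

End ElementarySymmetric.

Lemma nth_part_homo lam : is_part lam ->
  {homo nth 0%N lam : i j / (i <= j)%N >-> (j <= i)%N}.
Proof.
move=> sl i j ij; have [js|js] := ltnP j (size lam); last by rewrite nth_default.
have tr : transitive geq by move=> a b c /= ba ac; apply: leq_trans ac ba.
exact: (sorted_leq_nth tr (fun a => leqnn a) 0%N sl i j (leq_ltn_trans ij js) js ij).
Qed.

(** A nonzero entry at index n would make the first n + 1 entries nonzero. *)
Lemma nth_part_len lam n : is_part lam -> (part_len lam <= n)%N -> nth 0%N lam n = 0%N.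
Proof.
move=> sl ln; apply/eqP; apply: contraLR ln => ln0; rewrite -ltnNge.
have ns : (n < size lam)%N by rewrite ltnNge; apply: contra ln0 => /(nth_default 0%N)->.
rewrite /part_len -(cat_take_drop n.+1 lam) count_cat.
apply: leq_trans (leq_addr _ _).
suff : all (fun p => p != 0%N) (take n.+1 lam).
  by rewrite all_count => /eqP ->; rewrite size_takel.
apply/(all_nthP 0%N) => i; rewrite size_takel // => ni; rewrite nth_take //.
by rewrite -lt0n; apply: leq_trans (nth_part_homo sl (ni : (i <= n)%N)); rewrite lt0n.
Qed.

Lemma count_conj_part lam n i : is_part lam -> (part_len lam <= n)%N ->
  count (fun j => i < nth 0%N lam j)%N (iota 0 n) = conj_part lam i.+1.
Proof.
move=> sl ln; pose c k := count (fun j => i < nth 0%N lam j)%N (iota 0 k).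
have cz k k' : (k <= k')%N -> nth 0%N lam k = 0%N -> c k' = c k.
  move=> kk k0; rewrite /c -(subnKC kk) iotaD count_cat.
  rewrite [X in (_ + X)%N](_ : _ = 0%N) ?addn0 //.
  apply/eqP; rewrite -leqn0 leqNgt -has_count; apply/hasPn => j.
  rewrite mem_iota => /andP[kj _]; rewrite -leqNgt.
  by apply: leq_trans (nth_part_homo sl kj) _; rewrite k0.
have -> : conj_part lam i.+1 = c (size lam).
  by rewrite /conj_part -{1}(mkseq_nth 0%N lam) /mkseq count_map.
have [ns|ns] := leqP n (size lam); first by rewrite -/(c n) (cz _ _ ns) // nth_part_len.
by rewrite -/(c n) (cz _ _ (ltnW ns)) // nth_default.
Qed.

(** A column belonging to mu has index at least N, which switches the reflected term off; past mu
    the default entry 0 gives the indices N - 1, ..., 0, where it is on. *)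
Lemma col_fun_dual_L (F : fieldType) (h : int -> F) N mu i (a : nat) : (i < size mu + N)%N ->
  col_fun h mu N i a = dual_L h N a (nth 0%N mu i + (size mu + N - i.+1)).
Proof.
elim: mu i => [|p mu IH] i.
  rewrite add0n /= nth_nil add0n /vac_col /dual_L => iN.
  by rewrite ifT; [congr (h _ + h _); lia|lia].
case: i => [|i] /=; last by rewrite addSn subSS ltnS => /IH.
by rewrite /dual_L ifF ?addr0 ?addSn ?subn1 //; lia.
Qed.

Theorem theoremA3 (F : fieldType) (charF0 : [pchar F] =i pred0)
    (l N s : nat) (hl : (1 <= l)%N) (hN : (1 <= N)%N) (hs : (1 <= s)%N)
    (x : 'I_N -> F) (hx : forall i : 'I_N, x i != 0)
    (mu lam : seq nat) (hmu : is_part mu) (hlam : is_part lam)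
    (size_mu : size mu = l) (hsub : part_sub mu lam)
    (hlen : (part_len lam <= l + N)%N) (hlam1 : (nth 0%N lam 0 <= s)%N) :
  so_skew x lam mu =
  \det (\matrix_(i < s, j < s)
     (elem_pm x ((conj_part lam i.+1)%:Z - (conj_part mu j.+1)%:Z
                  - i.+1%:Z + j.+1%:Z)
      + elem_pm x ((conj_part lam i.+1)%:Z + (conj_part mu j.+1)%:Z
                  - i.+1%:Z - j.+1%:Z - (2 * l)%:Z + 1))).
Proof.
pose E := char_poly_pm x.
have E0 : E`_0 = 1 by rewrite /E char_poly_pm_sign elem_pm0 mul1r.
have [h [h0 h_neg Eh]] := series_inverse E0.
have size_pad : size (pad_part (size mu + N) lam) = (size mu + N)%N by rewrite size_mkseq.
have -> : so_skew x lam mu = \det (\matrix_(j < size mu + N, i < size mu + N)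
    col_fun h mu N i (nth 0 (shift_part (pad_part (size mu + N) lam)) j)).
  apply: (@so_bra_ket F (fock F) heis fvar (@fock_heis_lin F) (@heis_vac F)
    (@fock_heis_fvar F) (@fock_induction F) charF0 (fun _ _ => erefl) _
    (@dual_vac_lin F) dual_vac_vac (@dual_vac_fvar F) N x h mu) => //.
set n := (size mu + N)%N in size_pad *.
have mulam : (nth 0%N mu 0 <= s)%N by apply: leq_trans (hsub 0%N) hlam1.
have Ha := maya_part n (nth_part_homo hlam) hlam1.
have Hc := maya_part n (nth_part_homo hmu) mulam.
set a := shifted_part (nth 0%N lam) n in Ha; set a' := shifted_conj _ n s in Ha.
set c := shifted_part (nth 0%N mu) n in Hc; set c' := shifted_conj _ n s in Hc.
have -> : \matrix_(j < n, i < n) col_fun h mu N i (nth 0 (shift_part (pad_part n lam)) j) =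
    \matrix_(j < n, i < n) dual_L h N (nth 0%N a j) (nth 0%N c i).
  apply/matrixP => j i; rewrite !mxE nth_shift_part size_pad // nth_mkseq //.
  by rewrite col_fun_dual_L // /a /c !nth_mkseq.
rewrite (det_dual h0 h_neg Eh N Ha Hc) ?size_mkseq //.
have mu_len : (part_len mu <= l)%N by rewrite -size_mu count_size.
have a'E (i : 'I_s) : nth 0%N a' i = (n + i - conj_part lam i.+1)%N.
  by rewrite nth_mkseq // count_conj_part // /n size_mu.
have c'E (i : 'I_s) : nth 0%N c' i = (n + i - conj_part mu i.+1)%N.
  by rewrite nth_mkseq // count_conj_part // (leq_trans mu_len) // /n size_mu leq_addr.
have conj_mu i : (conj_part mu i <= l)%N by rewrite -size_mu count_size.
have conj_lam i : (conj_part lam i.+1 <= n)%N.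
  rewrite -(@count_conj_part lam n) //; last by rewrite /n size_mu.
  by rewrite -[leqRHS](size_iota 0 n) count_size.
pose X := \matrix_(i < s, j < s)
     (elem_pm x ((conj_part lam i.+1)%:Z - (conj_part mu j.+1)%:Z
                  - i.+1%:Z + j.+1%:Z)
      + elem_pm x ((conj_part lam i.+1)%:Z + (conj_part mu j.+1)%:Z
                  - i.+1%:Z - j.+1%:Z - (2 * l)%:Z + 1)).
pose sg (u : seq nat) : 'rV[F]_s := \row_i (-1) ^+ nth 0%N u i.
(* Rows belong to mu and columns to lam, hence the transpose. The sign (-1)^k of e_k splits into a
   row and a column factor, since k has the parity of c'_j + a'_i in the first term. *)
have -> : \matrix_(j < s, i < s) dual_M E N (nth 0%N c' j) (nth 0%N a' i) =
    diag_mx (sg c') *m X^T *m diag_mx (sg a').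
  apply/matrixP => j i; rewrite mul_mx_diag mul_diag_mx !mxE /dual_M c'E a'E.
  have cm := conj_mu j.+1; have cl := conj_lam i.
  have nE : n = (l + N)%N by rewrite /n size_mu.
  (* Since mu'_(j+1) <= l, the row index is at least N and the reflected term is present. *)
  rewrite ifT; last by lia.
  rewrite !coefz_char_poly_pm.
  have par (p q k : nat) : (p + q = k * 2)%N -> (-1) ^+ p = (-1) ^+ q :> F.
    move=> pq; transitivity ((-1) ^+ p * ((-1) ^+ q * (-1) ^+ q) : F).
      by rewrite -expr2 sqrr_sign mulr1.
    by rewrite mulrA -exprD pq mulnC exprM sqrrN !expr1n mul1r.
  set p := (n + j - _)%N; set q := (n + i - _)%N.
  have -> : (-1) ^+ absz (p%:Z - q%:Z)%R = (-1) ^+ (p + q) :> F.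
    by apply: (par _ _ (maxn p q)); lia.
  (* The reflected index has the opposite parity, which turns the minus sign of [dual_M] into a
     plus. *)
  have -> : (-1) ^+ absz ((2 * N)%:Z - 1 - p%:Z - q%:Z)%R = (-1) ^+ (p + q).+1 :> F.
    by apply: (par _ _ (maxn (p + q).+1 (2 * N) - N)%N); lia.
  have -> : p%:Z - q%:Z = (conj_part lam i.+1)%:Z - (conj_part mu j.+1)%:Z
      - i.+1%:Z + j.+1%:Z by rewrite /p /q; lia.
  have -> : (2 * N)%:Z - 1 - p%:Z - q%:Z = (conj_part lam i.+1)%:Z
      + (conj_part mu j.+1)%:Z - i.+1%:Z - j.+1%:Z - (2 * l)%:Z + 1 by rewrite /p /q; lia.
  by rewrite exprS mulN1r mulNr opprK -mulrDr exprD mulrAC.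
(* The two diagonal determinants reproduce the sign of [det_dual], so all signs occur squared. *)
rewrite !det_mulmx !det_diag det_tr -/X.
have sgE (u : seq nat) : size u = s -> \prod_(i < s) sg u 0 i = (-1) ^+ (\sum_(k <- u) k).
  move=> su; rewrite (big_nth 0%N) big_mkord su -prodrXr.
  by apply: eq_bigr => i _; rewrite mxE.
rewrite !sgE ?size_mkseq // exprD.
set y := (-1) ^+ _; set z := (-1) ^+ _.
have -> : y * z * (z * \det X * y) = (y * y) * (z * z) * \det X by ring.
by rewrite -!expr2 !sqrr_sign !mul1r.
Qed.
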